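(* Let $A$ be a commutative and countably generated $*$-algebra. Then $\mathrm{Rep}_{\mathrm{int}}(A)=\mathrm{Rep}_{\mathrm b}(A)$. That is, a representation $\pi$ of $A$ on a Hilbert module is locally bounded if and only if $\overline{\pi(a)}$ is regular and self-adjoint for all $a\in A$ with $a=a^*$.
   Context: Conventions. A $*$-algebra is a complex unital associative algebra with a conjugate-linear involution. Inner products are linear in the second variable. Let $D$ be a C*-algebra and $\mathcal E$ a Hilbert $D$-module. A representation of $A$ on $\mathcal E$ is a pair $(\mathfrak E,\pi)$ with $\mathfrak E\subseteq\mathcal E$ a dense $D$-submodule and $\pi\colon A\to\mathrm{End}_D(\mathfrak E)$ a unital algebra homomorphism with $\langle\pi(a)\xi,\eta\rangle=\langle\xi,\pi(a^* )\eta\rangle$ for all $a\in A$, $\xi,\eta\in\mathfrak E$. The graph topology on $\mathfrak E$ is generated by the norms $\|\langle\xi,\xi\rangle+\langle\pi(a)\xi,\pi(a)\xi\rangle\|^{1/2}$, $a\in A$; $\pi$ is closed if $\mathfrak E$ is complete in it. All representations are assumed closed. A densely defined operator $t$ on a Hilbert module is regular if it is closed, $t^*$ is densely defined, and $1+t^*t$ has dense range. $\mathrm{Rep}_{\mathrm{int}}(A)$ is the class of all representations $\pi$ on Hilbert modules (over arbitrary C*-algebras) such that the closure $\overline{\pi(a)}$ is regular and self-adjoint for all $a\in A$ with $a=a^*$. A C*-seminorm on $A$ is a submultiplicative seminorm $q$ with $q(a^*a)=q(a)^2$. For a representation $(\mathfrak E,\pi)$, a vector $\xi\in\mathfrak E$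 is bounded if there are a C*-seminorm $q$ on $A$ and $C>0$ with $\|\pi(a)\xi\|\le Cq(a)$ for all $a\in A$. The representation is locally bounded if the bounded vectors are dense in $\mathfrak E$ in the graph topology; $\mathrm{Rep}_{\mathrm b}(A)$ is the class of these. *)

(* Defs.v *)
From HB Require Import structures.
From mathcomp Require Import all_boot all_order all_algebra.
From mathcomp Require Import complex.
From mathcomp Require Import all_classical all_reals all_analysis.

Set Implicit Arguments.
Unset Strict Implicit.
Unset Printing Implicit Defensive.

Import Order.TTheory GRing.Theory Num.Theory.
Import numFieldNormedType.Exports.

Local Open Scope classical_set_scope.
Local Open Scope complex_scope.
Local Open Scope ring_scope.

(* The product is part of the structure instead of coming from a ring:
   C*-algebras need not be unital, and [GRing.Algebra] excludes the zero algebra. *)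
HB.mixin Record isStarAlgebra (R : realType) A of GRing.Lmodule R[i] A := {
  amul : A -> A -> A;
  star : A -> A;
  amulA : forall a b c : A, amul a (amul b c) = amul (amul a b) c;
  amulDl : forall a b c : A, amul (a + b) c = amul a c + amul b c;
  amulDr : forall a b c : A, amul a (b + c) = amul a b + amul a c;
  amulZl : forall (k : R[i]) (a b : A), amul (k *: a) b = k *: amul a b;
  amulZr : forall (k : R[i]) (a b : A), amul a (k *: b) = k *: amul a b;
  starK : forall a : A, star (star a) = a;
  starD : forall a b : A, star (a + b) = star a + star b;
  starZ : forall (k : R[i]) (a : A), star (k *: a) = Num.conj k *: star a;
  starM : forall a b : A, star (amul a b) = amul (star b) (star a) }.

#[short(type="starAlgType")]
HB.structure Definition StarAlgebra (R : realType) :=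
  {A of GRing.Lmodule R[i] A & isStarAlgebra R A}.

HB.mixin Record isUnitalStarAlgebra (R : realType) A of StarAlgebra R A := {
  aone : A;
  amul1l : forall a : A, amul aone a = a;
  amul1r : forall a : A, amul a aone = a }.

#[short(type="unitalStarAlgType")]
HB.structure Definition UnitalStarAlgebra (R : realType) :=
  {A of StarAlgebra R A & isUnitalStarAlgebra R A}.

HB.mixin Record isCstarAlgebra (R : realType) D
    of CompleteNormedModule R[i] D & isStarAlgebra R D := {
  cnormM : forall x y : D, `|amul x y| <= `|x| * `|y|;
  cnorm_star : forall x : D, `|amul (star x) x| = `|x| ^+ 2 }.

#[short(type="cstarAlgType")]
HB.structure Definition CstarAlgebra (R : realType) :=
  {D of CompleteNormedModule R[i] D & isStarAlgebra R D & isCstarAlgebra R D}.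

Definition cpositive (R : realType) (D : cstarAlgType R) (x : D) : Prop :=
  exists y : D, x = amul (star y) y.

(* Right Hilbert modules, complete for the norm [inner_norm]; definiteness
   of the inner product follows from that of the norm. *)
HB.mixin Record isHilbertModule (R : realType) (D : cstarAlgType R) E
    of CompleteNormedModule R[i] E := {
  ract : E -> D -> E;
  inner : E -> E -> D;
  ractA : forall (x : E) (d e : D), ract x (amul d e) = ract (ract x d) e;
  ractDl : forall (x y : E) (d : D), ract (x + y) d = ract x d + ract y d;
  ractDr : forall (x : E) (d e : D), ract x (d + e) = ract x d + ract x e;
  ractZl : forall (k : R[i]) (x : E) (d : D), k *: ract x d = ract (k *: x) d;
  ractZr : forall (k : R[i]) (x : E) (d : D), k *: ract x d = ract x (k *: d);
  innerDr : forall x y z : E, inner x (y + z) = inner x y + inner x z;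
  innerZr : forall (k : R[i]) (x y : E), inner x (k *: y) = k *: inner x y;
  inner_ract : forall (x y : E) (d : D),
    inner x (ract y d) = amul (inner x y) d;
  inner_star : forall x y : E, star (inner x y) = inner y x;
  inner_pos : forall x : E, cpositive (inner x x);
  inner_norm : forall x : E, `|x| = sqrtC `|inner x x| }.

#[short(type="hilbertModType")]
HB.structure Definition HilbertModule (R : realType) (D : cstarAlgType R) :=
  {E of CompleteNormedModule R[i] E & isHilbertModule R D E}.

Section StarAlgebras.
Context {R : realType} (A : unitalStarAlgType R).

Definition unital_star_subalgebra (B : set A) : Prop :=
  [/\ B aone,
      forall a b, B a -> B b -> B (a + b),
      forall (k : R[i]) a, B a -> B (k *: a),
      forall a b, B a -> B b -> B (amul a b) &
      forall a, B a -> B (star a)].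

Definition countably_generated : Prop :=
  exists S : set A, countable S /\
    forall B : set A, unital_star_subalgebra B -> S `<=` B -> B = setT.

(* As for library norms, the values are in [R[i]]; [0 <= q a] makes them
   real. *)
Definition cstar_seminorm (q : A -> R[i]) : Prop :=
  [/\ forall a, 0 <= q a,
      forall a b, q (a + b) <= q a + q b,
      forall (k : R[i]) a, q (k *: a) = `|k| * q a,
      forall a b, q (amul a b) <= q a * q b &
      forall a, q (amul (star a) a) = q a ^+ 2].

End StarAlgebras.

(* Unbounded operators on a Hilbert module are represented by their graphs. *)
Section Operators.
Context {R : realType} {D : cstarAlgType R} {E : hilbertModType D}.
Implicit Types T : set (E * E).

Definition submodule (F : set E) : Prop :=
  [/\ F 0,
      forall x y, F x -> F y -> F (x + y),
      forall (k : R[i]) x, F x -> F (k *: x) &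
      forall x (d : D), F x -> F (ract x d)].

Definition op_dom T : set E := [set x | exists y, T (x, y)].

Definition is_operator T : Prop :=
  [/\ T (0, 0),
      forall x y x' y', T (x, y) -> T (x', y') -> T (x + x', y + y'),
      forall (k : R[i]) x y, T (x, y) -> T (k *: x, k *: y),
      forall x y (d : D), T (x, y) -> T (ract x d, ract y d) &
      forall x y z, T (x, y) -> T (x, z) -> y = z].

Definition op_adjoint T : set (E * E) :=
  [set p | forall x y, T (x, y) -> inner y p.1 = inner x p.2].

(* The range of [1 + t^* t], where [t] has graph [T]. *)
Definition range_one_plus_adj T : set E :=
  [set z | exists x y w, [/\ T (x, y), op_adjoint T (y, w) & z = x + w]].

Definition op_regular T : Prop :=
  [/\ is_operator T, dense (op_dom T), closed T,
      dense (op_dom (op_adjoint T)) & dense (range_one_plus_adj T)].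

Definition op_selfadjoint T : Prop := op_adjoint T = T.

End Operators.

(* The values of [rep_op a] outside [rep_dom] are irrelevant. *)
Record representation (R : realType) (A : unitalStarAlgType R)
    (D : cstarAlgType R) (E : hilbertModType D) := Representation {
  rep_dom : set E;
  rep_op : A -> E -> E;
  rep_dom_submodule : submodule rep_dom;
  rep_dom_dense : dense rep_dom;
  rep_op_dom : forall a x, rep_dom x -> rep_dom (rep_op a x);
  rep_opD : forall a x y, rep_dom x -> rep_dom y ->
    rep_op a (x + y) = rep_op a x + rep_op a y;
  rep_opZ : forall a (k : R[i]) x, rep_dom x ->
    rep_op a (k *: x) = k *: rep_op a x;
  rep_op_ract : forall a x (d : D), rep_dom x ->
    rep_op a (ract x d) = ract (rep_op a x) d;
  rep_add : forall a b x, rep_dom x ->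
    rep_op (a + b) x = rep_op a x + rep_op b x;
  rep_scale : forall (k : R[i]) a x, rep_dom x ->
    rep_op (k *: a) x = k *: rep_op a x;
  rep_mul : forall a b x, rep_dom x ->
    rep_op (amul a b) x = rep_op a (rep_op b x);
  rep_one : forall x, rep_dom x -> rep_op aone x = x;
  rep_star : forall a x y, rep_dom x -> rep_dom y ->
    inner (rep_op a x) y = inner x (rep_op (star a) y) }.

Section Representations.
Context {R : realType} {A : unitalStarAlgType R} {D : cstarAlgType R}
  {E : hilbertModType D} (pi : representation A E).

Definition graph_norm (a : A) (x : E) : R[i] :=
  sqrtC `|inner x x + inner (rep_op pi a x) (rep_op pi a x)|.

(* Entourages and neighbourhoods of the graph topology on [rep_dom pi]; both
   are filters on [E] that contain [rep_dom pi]. *)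
Definition graph_entourage : set_system (E * E) :=
  [set V | exists (s : seq A) (e : R[i]), 0 < e /\
    forall x y, rep_dom pi x -> rep_dom pi y ->
      (forall a, a \in s -> graph_norm a (x - y) < e) -> V (x, y)].

Definition graph_nbhs (x : E) : set_system E :=
  [set U | exists (s : seq A) (e : R[i]), 0 < e /\
    forall y, rep_dom pi y ->
      (forall a, a \in s -> graph_norm a (x - y) < e) -> U y].

Definition graph_cauchy (F : set_system E) : Prop :=
  F (rep_dom pi) /\ (F, F) --> graph_entourage.

Definition rep_closed : Prop :=
  forall F : set_system E, ProperFilter F -> graph_cauchy F ->
    exists x, rep_dom pi x /\ F --> graph_nbhs x.

Definition rep_graph (a : A) : set (E * E) :=
  [set p | rep_dom pi p.1 /\ p.2 = rep_op pi a p.1].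

Definition op_closure (a : A) : set (E * E) := closure (rep_graph a).

Definition Rep_int : Prop :=
  forall a : A, star a = a ->
    op_regular (op_closure a) /\ op_selfadjoint (op_closure a).

Definition bounded_vector (x : E) : Prop :=
  rep_dom pi x /\
  exists (q : A -> R[i]) (C : R[i]), [/\ cstar_seminorm q, 0 < C &
    forall a, `|rep_op pi a x| <= C * q a].

Definition Rep_b : Prop :=
  forall x, rep_dom pi x ->
    forall U, graph_nbhs x U -> U `&` bounded_vector !=set0.

End Representations.

(* Main.v *)
(* Everything happens on the domain, where the self-adjoint elements of [A] act as
   commuting symmetric operators. If [h] and [k] commute and are symmetric, then
   [|h x + i k x|^2 = |<x, (h^2 + k^2) x>|] is also the square of [|h x - i k x|]; hence
   [|h x|, |k x| <= |h x + i k x|], which replaces all use of positivity in [D].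

   If bounded vectors are dense, a Neumann series for a C*-seminorm [q] inverts [1 + i a]
   approximately on the vectors bounded by [q]; so [1 + i a], [1 - i a] and [1 + a^2] have
   dense range, which gives regularity and self-adjointness.

   Conversely, if [c = c^*] satisfies [|x| <= |c x|], then regularity and self-adjointness
   make the range of [c] dense. Apply this to [m (1 + a^2)], where [m] is a product of
   elements [1 + b^2]: as the norms [|m x|] define the graph topology and the domain is
   complete, [1 + a^2] is bijective on the domain. Its inverse [Q] gives, through a
   convergent square root, the positive part [F] of [2 Q - 1 = (1 - a^2) / (1 + a^2)]: a
   contraction commuting with [A] such that [|a F x| <= 2 |F x|], and replacing [a] by
   [t a] with [t -> 0] it tends to the identity. Cutting off countably many generators one
   after the other yields, near any vector, a vector [y] such that all elements of [A] are
   bounded on [A y]; their spectral radius there is a C*-seminorm that bounds [y]. *)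

Require Import Defs.
From HB Require Import structures.
From mathcomp Require Import all_boot all_order all_algebra.
From mathcomp Require Import complex.
From mathcomp Require Import all_classical all_reals all_analysis.
From mathcomp Require Import ring lra.

Set Implicit Arguments.
Unset Strict Implicit.
Unset Printing Implicit Defensive.

Import Order.TTheory GRing.Theory Num.Theory.
Import numFieldNormedType.Exports.

Local Open Scope classical_set_scope.
Local Open Scope complex_scope.
Local Open Scope ring_scope.

(* The square-zero extension [K (+) V], a commutative ring into which [V] embeds: [ring]
   decides identities between linear combinations there. *)
Definition sqz (K : comNzRingType) (V : lmodType K) : Type := (K * V)%type.

Section SquareZero.
Context {K : comNzRingType} {V : lmodType K}.
Implicit Types p q r : sqz V.

HB.instance Definition _ := GRing.Zmodule.on (sqz V).

Let one : sqz V := (1, 0).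
Let mul p q : sqz V := (p.1 * q.1, p.1 *: q.2 + q.1 *: p.2).

Fact sqz_mulA : associative mul.
Proof.
move=> [k u] [l v] [m w]; rewrite /mul /= mulrA !scalerDr !scalerA addrA.
by rewrite [k * m]mulrC [l * m]mulrC.
Qed.

Fact sqz_mulC : commutative mul.
Proof. by move=> p q; rewrite /mul mulrC addrC. Qed.

Fact sqz_mul1 : left_id one mul.
Proof. by move=> [k u]; rewrite /mul /= mul1r scale1r scaler0 addr0. Qed.

Fact sqz_mulD : left_distributive mul +%R.
Proof.
move=> [k u] [l v] [m w]; rewrite /mul; congr pair; rewrite /= ?mulrDl //.
by rewrite scalerDl scalerDr addrACA.
Qed.

Fact sqz_oner_neq0 : one != 0.
Proof. by apply/eqP => -[/eqP]; rewrite oner_eq0. Qed.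

HB.instance Definition _ := GRing.Zmodule_isComNzRing.Build (sqz V)
  sqz_mulA sqz_mulC sqz_mul1 sqz_mulD sqz_oner_neq0.

Definition sqzc (k : K) : sqz V := (k, 0).
Definition sqzv (v : V) : sqz V := (0, v).

Lemma sqzv_inj : injective sqzv. Proof. by move=> u v []. Qed.

Lemma sqzvD u v : sqzv (u + v) = sqzv u + sqzv v.
Proof. by rewrite /sqzv; congr pair; rewrite addr0. Qed.
Lemma sqzvN u : sqzv (- u) = - sqzv u.
Proof. by rewrite /sqzv; congr pair; rewrite oppr0. Qed.
Lemma sqzv0 : sqzv 0 = 0. Proof. by []. Qed.
Lemma sqzvZ k u : sqzv (k *: u) = sqzc k * sqzv u.
Proof. by congr pair; rewrite /= ?mulr0 // scale0r addr0. Qed.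

Fact sqzc_is_monoid_morphism : monoid_morphism sqzc.
Proof. by split=> // k l; congr pair; rewrite /= !scaler0 addr0. Qed.
Fact sqzc_is_zmod_morphism : zmod_morphism sqzc.
Proof. by move=> k l; congr pair; rewrite /= subr0. Qed.
HB.instance Definition _ := GRing.isZmodMorphism.Build K (sqz V) sqzc sqzc_is_zmod_morphism.
HB.instance Definition _ := GRing.isMonoidMorphism.Build K (sqz V) sqzc
  sqzc_is_monoid_morphism.

End SquareZero.

Section SquareZeroComplex.
Context {R : realType} {V : lmodType R[i]}.

Lemma sqzci : sqzc 'i * sqzc 'i = -1 :> sqz V.
Proof. by rewrite -rmorphM -expr2 sqrCi rmorphN1. Qed.

Lemma sqzc_half : 2 * sqzc (2^-1 : R)%:C = 1 :> sqz V.
Proof.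
rewrite -[2](rmorph_nat sqzc) -rmorphM -(rmorph_nat (real_complex R)) -rmorphM.
by rewrite divff ?rmorph1.
Qed.

(** The two relations that [ring] cannot know by itself, on the imaginary unit and on one half,
    enter as hypotheses for [lmod_ring] to use. *)
Lemma sqz_ring (u w : sqz V) :
  (sqzc 'i * sqzc 'i = -1 :> sqz V -> 2 * sqzc (2^-1 : R)%:C = 1 :> sqz V ->
   u = w) -> u = w.
Proof. by apply; [apply: sqzci | apply: sqzc_half]. Qed.

End SquareZeroComplex.

Ltac lmod := apply: sqzv_inj; rewrite !(sqzvD, sqzvN, sqzv0, sqzvZ).
Ltac lmod_ring :=
  lmod; apply: sqz_ring; let i2 := fresh in let h := fresh in move=> i2 h; ring: i2 h.

(** * Real-valued norms *)

Lemma Re_normE (R : realType) (k : R[i]) : `|k| = (complex.Re `|k|)%:C.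
Proof. by rewrite RRe_real ?normr_real. Qed.

Lemma Re_norm_ge0 (R : realType) (k : R[i]) : 0 <= complex.Re `|k|.
Proof. by rewrite -(@lecR R) -Re_normE; exact: normr_ge0. Qed.

(** Norms take values in [R[i]]; a copy in [R] makes them accessible to [lra] and [nra]. *)
Definition rnorm {R : realType} {V : normedModType R[i]} (x : V) : R :=
  complex.Re `|x|.

Section RealNorm.
Context {R : realType} {V : normedModType R[i]}.
Implicit Types x y : V.

Lemma rnormE x : `|x| = (rnorm x)%:C.
Proof. by rewrite /rnorm RRe_real ?normr_real. Qed.

Lemma rnorm_ge0 x : 0 <= rnorm x.
Proof. by rewrite -(@lecR R) -rnormE; exact: normr_ge0. Qed.

Lemma rnormD x y : rnorm (x + y) <= rnorm x + rnorm y.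
Proof. by rewrite -(@lecR R) rmorphD /= -!rnormE ler_normD. Qed.

Lemma rnormZ (k : R[i]) x : rnorm (k *: x) = complex.Re `|k| * rnorm x.
Proof.
apply/(@complexI R); rewrite rmorphM /= -!rnormE normrZ; congr (_ * _).
Qed.

Lemma rnormZr (t : R) x : rnorm (t%:C *: x) = `|t| * rnorm x.
Proof. by rewrite rnormZ normc_def /= expr0n addr0 sqrtr_sqr. Qed.

Lemma rnormZi x : rnorm ('i *: x) = rnorm x.
Proof. by rewrite rnormZ normCi mul1r. Qed.

Lemma rnormN x : rnorm (- x) = rnorm x.
Proof. by rewrite /rnorm normrN. Qed.

Lemma rnormB x y : rnorm (x - y) <= rnorm x + rnorm y.
Proof. by rewrite (le_trans (rnormD _ _)) // rnormN. Qed.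

Lemma rnormC x y : rnorm (x - y) = rnorm (y - x).
Proof. by rewrite -rnormN opprB. Qed.

Lemma rnorm_triB x y z : rnorm (x - z) <= rnorm (x - y) + rnorm (y - z).
Proof. by rewrite (le_trans _ (rnormD _ _)) // addrA subrK. Qed.

Lemma rnorm0 : rnorm (0 : V) = 0.
Proof. by rewrite /rnorm normr0. Qed.

Lemma rnorm_eq0 x : rnorm x = 0 -> x = 0.
Proof. by move=> x0; apply/eqP; rewrite -normr_eq0 rnormE x0. Qed.

End RealNorm.

(** * *-algebras and inner products *)

Section StarMore.
Context {R : realType} {A : starAlgType R}.
Implicit Types a b : A.

Lemma star0 : star 0 = 0 :> A.
Proof. by apply/(@addrI _ (star 0)); rewrite -starD !addr0. Qed.

Lemma starN a : star (- a) = - star a.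
Proof. by apply/eqP; rewrite -subr_eq0 opprK -starD addNr star0. Qed.

Lemma starZr (t : R) a : star (t%:C *: a) = t%:C *: star a.
Proof. by rewrite starZ conj_Creal // complex_real. Qed.

Lemma starZi a : star ('i *: a) = - ('i *: star a).
Proof. by rewrite starZ conjCi scaleNr. Qed.

Definition re_part a : A := (2^-1 : R)%:C *: (a + star a).
Definition im_part a : A := (2^-1 : R)%:C *: ('i *: (star a - a)).

Lemma star_re_part a : star (re_part a) = re_part a.
Proof. by rewrite /re_part starZr starD starK addrC. Qed.

Lemma star_im_part a : star (im_part a) = im_part a.
Proof.
by rewrite /im_part starZr starZi starD starK starN -scalerN opprD opprK addrC.
Qed.

Lemma re_im_part a : a = re_part a + 'i *: im_part a.
Proof. by rewrite /re_part /im_part; lmod_ring. Qed.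

End StarMore.

Section UnitalStar.
Context {R : realType} {A : unitalStarAlgType R}.
Implicit Types a b : A.

Definition onesqr a : A := aone + amul a a.

Lemma star_one : star aone = aone :> A.
Proof. by rewrite -[LHS]amul1r -{2}[aone]starK -starM amul1r starK. Qed.

Lemma star_sqr a : star a = a -> star (amul a a) = amul a a.
Proof. by move=> aE; rewrite starM aE. Qed.

Lemma star_onesqr a : star a = a -> star (onesqr a) = onesqr a.
Proof. by move=> aE; rewrite starD star_one star_sqr. Qed.

(** Real parts of the generators sit at even indices, imaginary parts at odd ones. *)
Lemma countably_generated_sym : countably_generated A ->
  exists2 g : nat -> A, forall n, star (g n) = g n &
    forall B : set A, unital_star_subalgebra B -> (forall n, B (g n)) -> B = setT.
Proof.
move=> [S [/countable_injP[f finj] Sgen]].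
(* Indices outside the image of [f] get the harmless generator 0. *)
pose h n : A := xget 0 [set s | S s /\ f s = n].
exists (fun n => if odd n then im_part (h n./2) else re_part (h n./2)) => [n|B Balg Bg].
  by case: ifP => _; rewrite ?star_im_part ?star_re_part.
apply: Sgen => // s Ss; have hs : h (f s) = s.
  rewrite /h; case: xgetP => [x _ [Sx fx]|/(_ s)]; last by case.
  by apply: finj => //; rewrite inE.
have [_ BD BZ _ _] := Balg.
rewrite -hs [h _]re_im_part; apply: BD; last apply: BZ.
  by have := Bg (f s).*2; rewrite odd_double doubleK.
by have := Bg (f s).*2.+1; rewrite /= odd_double uphalf_double.
Qed.

Hypothesis Acomm : forall a b : A, amul a b = amul b a.

Lemma star_amul a b : star a = a -> star b = b -> star (amul a b) = amul a b.
Proof. by move=> aE bE; rewrite starM aE bE Acomm. Qed.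

End UnitalStar.

Lemma expr_small (R : realType) (r C e : R) : 0 <= r -> r < 1 -> 0 <= C -> 0 < e ->
  exists N, forall n, (N <= n)%N -> C * r ^+ n <= e.
Proof.
move=> r0 r1 C0 e0; have C1 : 0 < C + 1 by rewrite ltr_wpDl.
have rn : `|r| < 1 by rewrite ger0_norm.
have /cvgrPdist_le/(_ _ (divr_gt0 e0 C1))[N _ rN] := cvg_expr rn.
exists N => n /rN /=; rewrite sub0r normrN ger0_norm ?exprn_ge0 // ler_pdivlMr // => le.
by apply: le_trans le; rewrite mulrC ler_wpM2l ?exprn_ge0 // lerDl.
Qed.

Section InnerProduct.
Context {R : realType} {D : cstarAlgType R} {E : hilbertModType D}.
Implicit Types x y z : E.

(** The C*-identity gives [|d|^2 <= |star d| |d|]; cancel [|d|] and exchange [d] with [star d]. *)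
Lemma rnorm_star (d : D) : rnorm (star d) = rnorm d.
Proof.
wlog suff le : d / rnorm d <= rnorm (star d).
  by apply/le_anti; rewrite le -{2}(starK d) le.
have := cnormM (star d) d; rewrite cnorm_star !rnormE -rmorphXn -rmorphM lecR expr2.
have := rnorm_ge0 d; rewrite le_eqVlt => /predU1P[<- _|d0]; first exact: rnorm_ge0.
by rewrite ler_pM2r.
Qed.

Lemma rnormM (d e : D) : rnorm (amul d e) <= rnorm d * rnorm e.
Proof. by rewrite -(@lecR R) rmorphM /= -!rnormE cnormM. Qed.

Lemma innerDl x y z : inner (x + y) z = inner x z + inner y z.
Proof. by rewrite -inner_star innerDr starD !inner_star. Qed.

Lemma innerZl (k : R[i]) x y : inner (k *: x) y = Num.conj k *: inner x y.
Proof. by rewrite -inner_star innerZr starZ inner_star. Qed.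

Lemma innerNr x y : inner x (- y) = - inner x y.
Proof. by rewrite -scaleN1r innerZr scaleN1r. Qed.

Lemma innerNl x y : inner (- x) y = - inner x y.
Proof. by rewrite -inner_star innerNr starN inner_star. Qed.

Lemma inner0r x : inner x 0 = 0.
Proof. by rewrite -(scale0r 0) innerZr scale0r. Qed.

Lemma inner_ractl x y (d : D) : inner (ract x d) y = amul (star d) (inner x y).
Proof. by rewrite -inner_star inner_ract starM inner_star. Qed.

Lemma rnorm_sqr x : rnorm x ^+ 2 = rnorm (inner x x).
Proof.
apply/(@complexI R); rewrite rmorphXn /= -!rnormE.
by rewrite (inner_norm (s:=E)) sqrtCK.
Qed.

Lemma innerZir x y : inner x ('i *: y) = 'i *: inner x y.
Proof. exact: innerZr. Qed.

Lemma innerZil x y : inner ('i *: x) y = - ('i *: inner x y).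
Proof. by rewrite innerZl conjCi scaleNr. Qed.

Lemma rnorm_ract x (d : D) : rnorm (ract x d) <= rnorm x * rnorm d.
Proof.
rewrite -(@ler_pXn2r _ 2) ?nnegrE ?mulr_ge0 ?rnorm_ge0 //.
rewrite rnorm_sqr inner_ract inner_ractl (le_trans (rnormM _ _)) //.
rewrite exprMn rnorm_sqr [_ ^+ 2]expr2 mulrA ler_wpM2r ?rnorm_ge0 //.
by rewrite (le_trans (rnormM _ _)) // rnorm_star mulrC.
Qed.

Lemma polarization x y :
  4%:R *: inner x y =
    (inner (x + y) (x + y) - inner (x - y) (x - y)) -
    'i *: (inner (x + 'i *: y) (x + 'i *: y)
           - inner (x - 'i *: y) (x - 'i *: y)).
Proof.
rewrite !(innerDl, innerDr, innerNl, innerNr, innerZir, innerZil).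
by lmod_ring.
Qed.

(* The optimal constant 1 would need the order structure of [D]; any constant will do. *)
Lemma rnorm_inner x y : rnorm (inner x y) <= 4 * rnorm x * rnorm y.
Proof.
have sq (u v : E) : rnorm (inner (u + v) (u + v)) <= (rnorm u + rnorm v) ^+ 2.
  by rewrite -rnorm_sqr ler_pXn2r ?nnegrE ?addr_ge0 ?rnorm_ge0 ?rnormD.
(* By polarization, four squares of size at most [(|u| + |v|)^2] bound [4 <u,v>]. *)
have bound (u v : E) : rnorm (inner u v) <= (rnorm u + rnorm v) ^+ 2.
  have := rnormZr 4 (inner u v); rewrite rmorph_nat polarization ger0_norm // => E4.
  rewrite -(@ler_pM2l _ 4) // -E4.
  have := sq u v; have := sq u (- v); have := sq u ('i *: v).
  have := sq u (- ('i *: v)); rewrite !rnormN !rnormZi => h1 h2 h3 h4.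
  rewrite (le_trans (rnormB _ _)) // rnormZi.
  have := rnormB (inner (u + v) (u + v)) (inner (u - v) (u - v)).
  have := rnormB (inner (u + 'i *: v) (u + 'i *: v)) (inner (u - 'i *: v) (u - 'i *: v)).
  lra.
have := rnorm_ge0 x; rewrite le_eqVlt => /predU1P[x0|x0].
  rewrite (rnorm_eq0 (esym x0)) -[inner 0 y]inner_star inner0r star0.
  by rewrite !rnorm0 !(mulr0, mul0r).
have := rnorm_ge0 y; rewrite le_eqVlt => /predU1P[y0|y0].
  by rewrite (rnorm_eq0 (esym y0)) inner0r !rnorm0 !mulr0.
(* Rescaled, both vectors have norm [s t], so [bound] gives [4 (s t)^2] for [s t <x,y>]. *)
set s := rnorm x; set t := rnorm y.
have := bound (t%:C *: x) (s%:C *: y).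
rewrite innerZl innerZr !rnormZr -/s -/t.
rewrite conj_Creal ?complex_real // rnormZr rnormZr !gtr0_norm //.
have -> : (t * s + s * t) ^+ 2 = t * (s * (4 * s * t)) by ring.
by rewrite !ler_pM2l.
Qed.

(* [x -+ i y] has the same square [<x,x> + <y,y>], and [x], [y] are
   half-sums of the two vectors. *)
Lemma rnorm_comb x y : inner x y = inner y x ->
  rnorm x <= rnorm (y + 'i *: x) /\ rnorm y <= rnorm (y + 'i *: x).
Proof.
move=> xy.
have E1 : rnorm (y - 'i *: x) = rnorm (y + 'i *: x).
  apply: (@pexpIrn _ 2); rewrite ?nnegrE ?rnorm_ge0 // !rnorm_sqr.
  congr rnorm; rewrite !(innerDl, innerDr, innerNl, innerNr, innerZir, innerZil) xy.
  by lmod_ring.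
have half (z : E) : 2 * rnorm z = rnorm (2%:C *: z) by rewrite rnormZr ger0_norm.
split; rewrite -(@ler_pM2l _ 2) // half.
  have -> : 2%:C *: x = - 'i *: ((y + 'i *: x) - (y - 'i *: x)) by lmod_ring.
  rewrite scaleNr rnormN rnormZi (le_trans (rnormB _ _)) // E1; lra.
have -> : 2%:C *: y = (y + 'i *: x) + (y - 'i *: x) by lmod_ring.
rewrite (le_trans (rnormD _ _)) // E1; lra.
Qed.

End InnerProduct.

(** * The domain as a module over the algebra *)

Section Domain.
Context {R : realType} {A : unitalStarAlgType R} {D : cstarAlgType R}
  {E : hilbertModType D} (pi : representation A E).

Definition in_dom : {pred E} := fun x => `[< rep_dom pi x >].

Fact in_dom_submod : submod_closed in_dom.
Proof.
have [d0 dD dZ _] := rep_dom_submodule pi; split; first exact/asboolP.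
by move=> k x y /asboolP xd /asboolP yd; apply/asboolP/dD => //; apply: dZ.
Qed.

HB.instance Definition _ := GRing.isSubmodClosed.Build _ E in_dom in_dom_submod.

(** With the domain as a type, each represented element is a total linear map and its laws lose the
    side condition [rep_dom pi x]. *)
Definition domain : Type := {x : E | x \in in_dom}.
HB.instance Definition _ := SubChoice.on domain.
HB.instance Definition _ := [SubChoice_isSubLmodule of domain by <:].

Implicit Types (a b : A) (x y : domain).

Lemma domainP x : rep_dom pi (val x).
Proof. exact/asboolP/(valP x). Qed.

Definition mkdom (x : E) (xd : rep_dom pi x) : domain :=
  exist _ x (introT (asboolP _) xd).

Lemma valD x y : val (x + y) = val x + val y. Proof. by []. Qed.
Lemma valZ (k : R[i]) x : val (k *: x) = k *: val x. Proof. by []. Qed.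

Definition act a x : domain := mkdom (rep_op_dom a (domainP x)).

Lemma actD a x y : act a (x + y) = act a x + act a y.
Proof. by apply: val_inj; rewrite /= rep_opD //; exact: domainP. Qed.

Lemma actZ a (k : R[i]) x : act a (k *: x) = k *: act a x.
Proof. by apply: val_inj; rewrite /= rep_opZ //; exact: domainP. Qed.

HB.instance Definition _ a := GRing.isSemilinear.Build _ _ _ _ (act a) (actZ a, actD a).

Lemma act_add a b x : act (a + b) x = act a x + act b x.
Proof. by apply: val_inj; rewrite raddfD /= rep_add //; exact: domainP. Qed.

Lemma act_scale (k : R[i]) a x : act (k *: a) x = k *: act a x.
Proof. by apply: val_inj; rewrite linearZ /= rep_scale //; exact: domainP. Qed.

Lemma act_mul a b x : act (amul a b) x = act a (act b x).
Proof. by apply: val_inj; rewrite /= rep_mul //; exact: domainP. Qed.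

Lemma act_one x : act aone x = x.
Proof. by apply: val_inj; rewrite /= rep_one //; exact: domainP. Qed.

Definition vnorm x : R := rnorm (val x).
Definition vip x y : D := inner (val x) (val y).

Lemma vip_act a x y : vip (act a x) y = vip x (act (star a) y).
Proof. by rewrite /vip /= rep_star //; exact: domainP. Qed.

Lemma vnorm_ge0 x : 0 <= vnorm x. Proof. exact: rnorm_ge0. Qed.
Lemma vnormD x y : vnorm (x + y) <= vnorm x + vnorm y.
Proof. by rewrite /vnorm raddfD rnormD. Qed.
Lemma vnormB x y : vnorm (x - y) <= vnorm x + vnorm y.
Proof. by rewrite /vnorm raddfB rnormB. Qed.
Lemma vnormN x : vnorm (- x) = vnorm x.
Proof. by rewrite /vnorm raddfN rnormN. Qed.
Lemma vnormC x y : vnorm (x - y) = vnorm (y - x).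
Proof. by rewrite -vnormN opprB. Qed.
Lemma vnorm0 : vnorm 0 = 0. Proof. by rewrite /vnorm raddf0 rnorm0. Qed.
Lemma vnorm_eq0 x : vnorm x = 0 -> x = 0.
Proof. by move=> /rnorm_eq0 x0; apply: val_inj; rewrite x0 raddf0. Qed.
Lemma vnormZ (k : R[i]) x : vnorm (k *: x) = complex.Re `|k| * vnorm x.
Proof. by rewrite /vnorm linearZ rnormZ. Qed.
Lemma vnormZr (t : R) x : vnorm (t%:C *: x) = `|t| * vnorm x.
Proof. by rewrite /vnorm linearZ rnormZr. Qed.
Lemma vnormZi x : vnorm ('i *: x) = vnorm x.
Proof. by rewrite /vnorm linearZ rnormZi. Qed.
Lemma vnorm_triB x y z : vnorm (x - z) <= vnorm (x - y) + vnorm (y - z).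
Proof. by rewrite (le_trans _ (vnormD _ _)) // addrA subrK. Qed.
Lemma vip_le x y : rnorm (vip x y) <= 4 * vnorm x * vnorm y.
Proof. exact: rnorm_inner. Qed.
Lemma vnorm_sqr x : vnorm x ^+ 2 = rnorm (vip x x).
Proof. exact: rnorm_sqr. Qed.

Lemma vnorm_comb x y : vip x y = vip y x ->
  vnorm x <= vnorm (y + 'i *: x) /\ vnorm y <= vnorm (y + 'i *: x).
Proof. by move=> /rnorm_comb; rewrite /vnorm valD valZ. Qed.

Lemma vip_acts a x y : star a = a -> vip (act a x) y = vip x (act a y).
Proof. by move=> aE; rewrite vip_act aE. Qed.

Lemma vnorm_comb_sym a x : star a = a ->
  vnorm x <= vnorm (act a x + 'i *: x) /\
  vnorm (act a x) <= vnorm (act a x + 'i *: x).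
Proof. by move=> aE; apply: vnorm_comb; rewrite vip_acts. Qed.

Lemma act_onesqr a x : act (onesqr a) x = x + act a (act a x).
Proof. by rewrite act_add act_one act_mul. Qed.

(* [1 + a^2 = (a + i)(a - i)], and [a +- i] do not decrease norms. *)
Lemma vnorm_onesqr a x : star a = a ->
  vnorm x <= vnorm (act (onesqr a) x) /\
  vnorm (act a x) <= vnorm (act (onesqr a) x).
Proof.
move=> aE; pose u := act a x - 'i *: x.
have -> : act (onesqr a) x = act a u + 'i *: u.
  rewrite act_onesqr /u raddfB /= linearZ /=; lmod_ring.
have [le1 le2] := vnorm_comb_sym u aE.
have uE : u = - 'i *: (x + 'i *: act a x) by rewrite /u; lmod_ring.
have [|le3 le4] := vnorm_comb (x := act a x) (y := x); first by rewrite vip_acts.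
have uN : vnorm u = vnorm (x + 'i *: act a x) by rewrite uE scaleNr vnormN vnormZi.
by rewrite -uN in le3 le4; split; apply: le_trans le1.
Qed.

End Domain.

(** * Norm descriptions of neighbourhoods, density and closure *)

Section Topology.
Context {R : realType} {V : completeNormedModType R[i]}.
Implicit Types x y : V.

Lemma complex_gt0 (e : R[i]) : 0 < e -> exists2 e' : R, 0 < e' & e = e'%:C.
Proof.
move=> e0; have eE : (complex.Re e)%:C = e by rewrite RRe_real ?gtr0_real.
by exists (complex.Re e) => //; rewrite -(@ltcR R) eE.
Qed.

Lemma nbhs_rnormP x (B : set V) :
  nbhs x B <-> exists2 e : R, 0 < e & forall y, rnorm (x - y) < e -> B y.
Proof.
split=> [/nbhs_ballP[_ /complex_gt0[e e0 ->]] sB|[e e0 eB]].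
  exists e => // y xy; apply: sB.
  by rewrite -ball_normE /ball_ /= rnormE ltcR.
apply/nbhs_ballP; exists e%:C => [|y]; first by rewrite /= ltcR.
by rewrite -ball_normE /ball_ /= rnormE ltcR => /eB.
Qed.

Lemma dense_rnormP (S : set V) :
  dense S <-> forall y (e : R), 0 < e -> exists2 x, S x & rnorm (x - y) < e.
Proof.
split=> [Sd y e e0|Sd O [y Oy] oO].
  have [x [/interior_subset xy Sx]] : (interior [set x | rnorm (x - y) < e] `&` S) !=set0.
    apply: Sd; last exact: open_interior.
    by exists y; apply/nbhs_rnormP; exists e => // z; rewrite rnormC.
  by exists x.
have /nbhs_rnormP[e e0 eO] : nbhs y O by apply: open_nbhs_nbhs.
have [x Sx xy] := Sd y e e0.
by exists x; split=> //; apply: eO; rewrite rnormC.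
Qed.

Lemma closure_rnormP (S : set (V * V)) u v :
  closure S (u, v) <-> forall e : R, 0 < e ->
    exists x y, [/\ S (x, y), rnorm (u - x) < e & rnorm (v - y) < e].
Proof.
split=> [uv e e0|uv B].
  have [|[x y] [Sxy [ux vy]]] := uv [set p | rnorm (u - p.1) < e /\ rnorm (v - p.2) < e].
    exists ([set x | rnorm (u - x) < e], [set y | rnorm (v - y) < e]).
      by split; apply/nbhs_rnormP; exists e.
    by case.
  by exists x, y.
move=> [[B1 B2] [/nbhs_rnormP[e1 e10 eB1] /nbhs_rnormP[e2 e20 eB2]]] sB.
have [|x [y [Sxy ux vy]]] := uv (Num.min e1 e2); first by rewrite lt_min e10.
rewrite !lt_min in ux vy; case/andP: ux => ux _; case/andP: vy => _ vy.
by exists (x, y); split=> //; apply: sB; split; [apply: eB1 | apply: eB2].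
Qed.

Lemma rnorm_small0 (C : R) x : (forall e : R, 0 < e -> rnorm x <= C * e) -> x = 0.
Proof.
move=> xC; apply: rnorm_eq0; apply/le_anti; rewrite rnorm_ge0 andbT.
have C0 : 0 <= C by have := xC 1 ltr01; rewrite mulr1; apply: le_trans (rnorm_ge0 x).
apply/ler_addgt0Pr => e e0; rewrite add0r.
apply: le_trans (xC (e / (C + 1)) _) _; first by rewrite divr_gt0 // ltr_wpDl.
rewrite mulrCA ler_piMr ?(ltW e0) // ler_pdivrMr ?ltr_wpDl //; lra.
Qed.

End Topology.

(** * Closures of the operators *)

Section Closure.
Context {R : realType} {A : unitalStarAlgType R} {D : cstarAlgType R}
  {E : hilbertModType D} (pi : representation A E).
Implicit Types (a b : A) (x y : domain pi) (u v : E).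

Lemma domain_dense u (e : R) : 0 < e -> exists x, rnorm (val x - u) < e.
Proof.
move=> e0; have /dense_rnormP/(_ u e e0)[x xd ux] := @rep_dom_dense _ _ _ _ pi.
by exists (mkdom xd).
Qed.

Lemma op_closureP a u v :
  op_closure pi a (u, v) <-> forall e : R, 0 < e ->
    exists x, rnorm (u - val x) < e /\ rnorm (v - val (act a x)) < e.
Proof.
rewrite /op_closure closure_rnormP; split=> uv e e0; have := uv e e0.
  by case=> x [y [[/= xd ->] ux vy]]; exists (mkdom xd).
case=> x [ux vx]; exists (val x), (val (act a x)); split=> //.
by split=> //; exact: domainP.
Qed.

Lemma op_closure_graph a x : op_closure pi a (val x, val (act a x)).
Proof. by apply/op_closureP => e e0; exists x; rewrite !subrr rnorm0. Qed.

Lemma op_closure_lin a (k : R[i]) u v u' v' :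
  op_closure pi a (u, v) -> op_closure pi a (u', v') ->
  op_closure pi a (u + k *: u', v + k *: v').
Proof.
move=> /op_closureP uv /op_closureP uv'; apply/op_closureP => e e0.
set t := complex.Re `|k|.
have t0 : 0 <= t := Re_norm_ge0 k.
have d0 : 0 < e / (1 + t) by rewrite divr_gt0 // ltr_wpDr.
have [x [ux vx]] := uv _ d0; have [x' [ux' vx']] := uv' _ d0.
exists (x + k *: x'); rewrite actD actZ !valD !valZ.
have small w w' z z' : rnorm (w - z) < e / (1 + t) -> rnorm (w' - z') < e / (1 + t) ->
    rnorm (w + k *: w' - (z + k *: z' : E)) < e.
  move=> wz wz'; rewrite opprD addrACA -scalerN -scalerDr.
  apply: le_lt_trans (rnormD _ _) _; rewrite rnormZ -/t.
  have -> : e = e / (1 + t) + t * (e / (1 + t)) by field; rewrite gt_eqF // ltr_wpDr.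
  by apply: ltr_leD => //; rewrite ler_wpM2l // ltW.
by split; apply: small.
Qed.

Lemma op_closure_ract a u v (d : D) :
  op_closure pi a (u, v) -> op_closure pi a (ract u d, ract v d).
Proof.
move=> /op_closureP uv; apply/op_closureP => e e0.
have d0 : 0 < rnorm d + 1 by rewrite ltr_wpDl ?rnorm_ge0.
have [x [ux vx]] := uv _ (divr_gt0 e0 d0).
have [_ _ _ dR] := rep_dom_submodule pi.
exists (mkdom (dR _ d (domainP x))); rewrite /= rep_op_ract; last exact: domainP.
have ractB (w z : E) : ract w d - ract z d = ract (w - z) d.
  by rewrite ractDl -[- z]scaleN1r -ractZl scaleN1r.
have small (w z : E) : rnorm (w - z) < e / (rnorm d + 1) -> rnorm (ract w d - ract z d) < e.
  move=> wz; rewrite ractB (le_lt_trans (rnorm_ract _ _)) //.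
  move: wz; rewrite ltr_pdivlMr // => wz; apply: le_lt_trans wz.
  by rewrite ler_wpM2l ?rnorm_ge0 // lerDl.
by split; apply: small.
Qed.

(** Symmetry passes to the closure one argument at a time: first here, then in [op_closure_sym]. *)
Lemma op_closure_dom a u v y : star a = a -> op_closure pi a (u, v) ->
  inner v (val y) = inner u (val (act a y)).
Proof.
move=> aE /op_closureP uv; apply/eqP; rewrite -subr_eq0; apply/eqP.
apply: (@rnorm_small0 _ _ (4 * (vnorm y + vnorm (act a y)))) => e e0.
have [x [ux vx]] := uv e e0.
have -> : inner v (val y) - inner u (val (act a y)) =
    inner (v - val (act a x)) (val y) - inner (u - val x) (val (act a y)).
  have := vip_acts x y aE; rewrite /vip !innerDl !innerNl => ->; lmod_ring.
apply: le_trans (rnormB _ _) _; rewrite mulrDr mulrDl.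
apply: lerD; apply: le_trans (rnorm_inner _ _) _; rewrite mulrAC.
  by rewrite ler_wpM2l ?mulr_ge0 ?rnorm_ge0 // ltW.
by rewrite ler_wpM2l ?mulr_ge0 ?rnorm_ge0 // ltW.
Qed.

Lemma op_closure_sym a u v u' v' : star a = a ->
  op_closure pi a (u, v) -> op_closure pi a (u', v') -> inner v u' = inner u v'.
Proof.
move=> aE uv /op_closureP uv'; apply/eqP; rewrite -subr_eq0; apply/eqP.
apply: (@rnorm_small0 _ _ (4 * (rnorm v + rnorm u))) => e e0.
have [y [uy vy]] := uv' e e0.
have -> : inner v u' - inner u v' =
    inner v (u' - val y) - inner u (v' - val (act a y)).
  have := op_closure_dom y aE uv; rewrite !innerDr !innerNr => ->; lmod_ring.
apply: le_trans (rnormB _ _) _; rewrite mulrDr mulrDl.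
by apply: lerD; apply: le_trans (rnorm_inner _ _) _;
  rewrite ler_wpM2l ?mulr_ge0 ?rnorm_ge0 // ltW.
Qed.

Lemma op_closure_ge a (t : R) u v : 0 <= t ->
  (forall x, t * vnorm x <= vnorm (act a x)) ->
  op_closure pi a (u, v) -> t * rnorm u <= rnorm v.
Proof.
move=> t0 at_ /op_closureP uv; apply/ler_addgt0Pr => e e0.
have d0 : 0 < e / (1 + t) by rewrite divr_gt0 // ltr_wpDr.
have [x [ux vx]] := uv _ d0.
have le1 : rnorm u <= vnorm x + e / (1 + t).
  by have := rnorm_triB u (val x) 0; rewrite !subr0 /vnorm; lra.
have le2 : vnorm (act a x) <= rnorm v + e / (1 + t).
  by have := rnorm_triB (val (act a x)) v 0; rewrite !subr0 /vnorm rnormC; lra.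
have le3 := at_ x.
have -> : e = t * (e / (1 + t)) + e / (1 + t) by field; rewrite gt_eqF // ltr_wpDr.
have := ler_wpM2l t0 le1; lra.
Qed.

(** Let [T] be the closure of [t c] for a large real [t]. Regularity and self-adjointness solve
    [x + T (T x) = z] with [z] near [u]. As [T] is bounded below by [t], the summand [x] is small,
    so [T (T x)], a limit of vectors [c (t xi)], is near [u]. *)
Lemma Rep_int_range_dense c u (e : R) : Rep_int pi -> star c = c ->
  (forall x, vnorm x <= vnorm (act c x)) -> 0 < e ->
  exists x, rnorm (val (act c x) - u) <= e.
Proof.
move=> piI cE cge e0.
(* Chosen so that [t e / 3] exceeds [|u| + e / 3], which bounds [|z|] and hence [t |x|]. *)
pose t := 1 + 3 * (rnorm u + e) / e.
have u0 := rnorm_ge0 u.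
have t1 : 1 <= t by rewrite /t lerDl divr_ge0 ?ltW //; lra.
have t0 : 0 <= t by lra.
pose c' := t%:C *: c.
have c'E : star c' = c' by rewrite starZr cE.
have [[_ _ _ _ /dense_rnormP dr] sa] := piI c' c'E.
have [|z [x [y [w [xy yw zE]]]] zu] := dr u (e / 3); first lra.
rewrite sa in yw.
have c'ge v v' : op_closure pi c' (v, v') -> t * rnorm v <= rnorm v'.
  apply: op_closure_ge => // xi; rewrite act_scale vnormZr ger0_norm //.
  by rewrite ler_wpM2l.
(* Here [z = (T + i)(T - i) x] and [w = T y] with [y = T x]. Both [|w| <= |y + i w| = |w - i y|] and
   [|w - i y| <= |z|] are instances of [rnorm_comb]. *)
have zw : rnorm w <= rnorm z.
  have uv := op_closure_lin (k := - 'i) yw xy.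
  have [_] := rnorm_comb (esym (op_closure_sym c'E uv uv)).
  have -> : w + - 'i *: y + 'i *: (y + - 'i *: x) = z by rewrite zE; lmod_ring.
  apply: le_trans; have -> : w + - 'i *: y = - 'i *: (y + 'i *: w) by lmod_ring.
  by rewrite scaleNr rnormN rnormZi; case: (rnorm_comb (op_closure_sym c'E yw yw)).
have xe : rnorm x <= e / 3.
  rewrite -(@ler_pM2l _ t); last lra.
  have -> : t * (e / 3) = e / 3 + rnorm u + e by rewrite /t; field; rewrite gt_eqF.
  have := c'ge _ _ xy; have := c'ge _ _ yw; have := rnorm_triB z u 0.
  have := ler_wpM2r (rnorm_ge0 y) t1; rewrite mul1r !subr0; lra.
have /op_closureP/(_ (e / 3))[|xi [_ wxi]] := yw; first lra.
exists (t%:C *: xi); rewrite linearZ /= -rep_scale; last exact: domainP.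
have := rnorm_triB (val (act c' xi)) w u; have := rnorm_triB w z u.
have -> : w - z = - x by rewrite zE opprD addrCA subrr addr0.
by rewrite rnormN [rnorm (_ - w)]rnormC /= -/c'; lra.
Qed.

End Closure.

Arguments op_closure_graph {R A D E pi} a x.

(** * The graph topology *)

Section Complete.
Context {R : realType} {A : unitalStarAlgType R} {D : cstarAlgType R}
  {E : hilbertModType D} (pi : representation A E).
Implicit Types (a b : A) (x y : domain pi).

(** The cross terms cancel by symmetry. So for self-adjoint [a] the graph norm is [|(a + i) x|],
    which dominates [|a x|] without any order on [D]. *)
Lemma vnorm_comb_sqr a x : star a = a ->
  vnorm (act a x + 'i *: x) ^+ 2 = rnorm (vip x x + vip (act a x) (act a x)).
Proof.
move=> aE; rewrite vnorm_sqr /vip valD valZ; congr rnorm.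
have := vip_acts x x aE.
rewrite /vip !(innerDl, innerDr, innerZir, innerZil) => ->; lmod_ring.
Qed.

Lemma graph_normE a x : graph_norm pi a (val x) =
  (Num.sqrt (rnorm (vip x x + vip (act a x) (act a x))))%:C.
Proof.
rewrite /graph_norm rnormE -[X in sqrtC X%:C](sqr_sqrtr (rnorm_ge0 _)).
by rewrite rmorphXn sqrCK // lecR sqrtr_ge0.
Qed.

Lemma graph_norm_le a x : graph_norm pi a (val x) <= (vnorm x + vnorm (act a x))%:C.
Proof.
rewrite graph_normE lecR -(ler_pXn2r (n := 2)) ?nnegrE ?sqrtr_ge0 ?addr_ge0 ?vnorm_ge0 //.
rewrite sqr_sqrtr ?rnorm_ge0 // (le_trans (rnormD _ _)) // -!vnorm_sqr.
have := mulr_ge0 (vnorm_ge0 x) (vnorm_ge0 (act a x)); nra.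
Qed.

Lemma graph_norm_ge a x : star a = a -> (vnorm (act a x))%:C <= graph_norm pi a (val x).
Proof.
move=> aE; rewrite graph_normE lecR -vnorm_comb_sqr // sqrtr_sqr ger0_norm.
  by case: (vnorm_comb_sym x aE).
exact: vnorm_ge0.
Qed.

Lemma vnorm_re_im b x :
  vnorm (act b x) <= vnorm (act (re_part b) x) + vnorm (act (im_part b) x).
Proof.
have -> : act b x = act (re_part b) x + 'i *: act (im_part b) x.
  by rewrite -act_scale -act_add -re_im_part.
by rewrite -(vnormZi (act (im_part b) x)) vnormD.
Qed.

(** The seminorms [|b x|] with arbitrary [b] define the same topology as the graph norms and are
    additive in use. *)
Definition graph_cauchy_seq (u : nat -> domain pi) :=
  forall b (e : R), 0 < e ->
    exists N, forall n, (N <= n)%N -> vnorm (act b (u n - u N)) <= e.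

Definition graph_limit (u : nat -> domain pi) x :=
  forall b (e : R), 0 < e ->
    exists N, forall n, (N <= n)%N -> vnorm (act b (u n - x)) <= e.

Lemma graph_cauchy_seqP u (s : seq A) (e : R) : graph_cauchy_seq u -> 0 < e ->
  exists N, forall m n, (N <= m)%N -> (N <= n)%N ->
    forall b, b \in s -> vnorm (act b (u m - u n)) <= e.
Proof.
move=> uC e0; elim: s => [|b s [N1 IH]]; first by exists 0%N.
have [N2 bN] := uC b (e / 2) ltac:(lra).
exists (maxn N1 N2) => m n; rewrite !geq_max => /andP[m1 m2] /andP[n1 n2] c.
rewrite inE => /orP[/eqP -> |cs]; last exact: IH.
have := bN m m2; have := bN n n2.
rewrite !raddfB /=; have := vnorm_triB (act b (u m)) (act b (u N2)) (act b (u n)).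
rewrite [vnorm (_ (u N2) - _)]vnormC; lra.
Qed.

Lemma graph_complete u : rep_closed pi -> graph_cauchy_seq u ->
  exists x, graph_limit u x.
Proof.
move=> piC uC.
pose F : set_system E := (fun n => val (u n)) @ \oo.
have FC : graph_cauchy pi F.
  split; first by exists 0%N => // n _; apply: domainP.
  move=> V [s [_ [/complex_gt0[e e0 ->] eV]]].
  (* The unit is added because [graph_norm a] is estimated by [|x| + |a x|]; two terms of [e / 3]
     stay strictly below [e]. *)
  have [N uN] := graph_cauchy_seqP (aone :: s) uC (divr_gt0 e0 (ltr0n _ 3)).
  pose B := [set v | exists2 n, (N <= n)%N & v = val (u n)].
  have FB : F B by exists N => // n /= Nn; exists n.
  exists (B, B) => // -[_ _] [/= [m Nm ->] [n Nn ->]].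
  apply: eV => [||a sa]; try exact: domainP.
  apply: (le_lt_trans (graph_norm_le a (u m - u n))); rewrite ltcR.
  have := uN m n Nm Nn aone; have := uN m n Nm Nn a.
  by rewrite !inE eqxx sa orbT act_one => /(_ isT) ? /(_ isT) ?; lra.
have [x [xd Fx]] := piC F _ FC.
exists (mkdom xd) => b e e0.
(* The graph norm of [b] controls [|b x|] only through [graph_norm_ge], hence for self-adjoint
   elements: split [b]. *)
have [|N _ uN] := Fx [set y | forall a, a \in [:: re_part b; im_part b] ->
    graph_norm pi a (x - y) < (e / 2)%:C].
  by exists [:: re_part b; im_part b], (e / 2)%:C; split; [rewrite ltcR; lra | move].
exists N => n /uN /= xy.
have lt a : a \in [:: re_part b; im_part b] -> star a = a ->
    vnorm (act a (u n - mkdom xd)) < e / 2.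
  move=> /xy xya aE; rewrite -opprB raddfN /= vnormN -ltcR.
  by apply: le_lt_trans xya; apply: (graph_norm_ge (mkdom xd - u n)).
apply: (le_trans (vnorm_re_im _ _)).
have := lt (re_part b); have := lt (im_part b); rewrite !inE !eqxx orbT /=.
by move=> /(_ isT (star_im_part _)) ? /(_ isT (star_re_part _)) ?; lra.
Qed.

Lemma graph_limit_act u x c : graph_limit u x ->
  graph_limit (fun n => act c (u n)) (act c x).
Proof.
move=> ux b e e0; have [N uN] := ux (amul b c) e e0; exists N => n /uN.
by rewrite act_mul raddfB.
Qed.

Lemma graph_limitD u v x y : graph_limit u x -> graph_limit v y ->
  graph_limit (fun n => u n + v n) (x + y).
Proof.
move=> ux vy b e e0.
have [N uN] := ux b (e / 2) ltac:(lra); have [M vM] := vy b (e / 2) ltac:(lra).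
exists (maxn N M) => n; rewrite geq_max => /andP[/uN h1 /vM h2].
by rewrite opprD addrACA raddfD (le_trans (vnormD _ _)) //=; lra.
Qed.

Lemma graph_limit_vnorm_le u x (C : R) : graph_limit u x ->
  (exists N, forall n, (N <= n)%N -> vnorm (u n) <= C) -> vnorm x <= C.
Proof.
move=> ux [M uM]; apply/ler_addgt0Pr => e e0.
have [N uN] := ux aone e e0.
have := uN _ (leq_maxl N M); have := uM _ (leq_maxr N M); rewrite act_one.
by have := vnormB (u (maxn N M)) (u (maxn N M) - x); rewrite opprB addrC subrK; lra.
Qed.

End Complete.

(** * A sequence of norms generating the graph topology *)

Section Dominating.
Context {R : realType} {A : unitalStarAlgType R} {D : cstarAlgType R}
  {E : hilbertModType D} (pi : representation A E).
Hypothesis Acomm : forall a b : A, amul a b = amul b a.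
Implicit Types (a b c : A) (x y : domain pi).

Lemma actC a b x : act a (act b x) = act b (act a x).
Proof. by rewrite -!act_mul Acomm. Qed.

(* [dom_elt g n] dominates the first [n] generators, and any product of two dominated
   elements is dominated further on; so its norms generate the graph topology. *)
Fixpoint dom_elt (g : nat -> A) n : A :=
  if n is m.+1 then amul (onesqr (g m)) (amul (dom_elt g m) (dom_elt g m))
  else aone.

Variable g : nat -> A.
Hypothesis g_sym : forall n, star (g n) = g n.

Lemma star_dom_elt n : star (dom_elt g n) = dom_elt g n.
Proof.
elim: n => [|n IH] /=; first exact: star_one.
by rewrite !star_amul ?star_onesqr ?star_amul.
Qed.

Lemma dom_elt_ge1 n x : vnorm x <= vnorm (act (dom_elt g n) x).
Proof.
elim: n x => [|n IH] x /=; first by rewrite act_one.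
rewrite !act_mul; apply: le_trans (vnorm_onesqr _ (g_sym n)).1.
exact: le_trans (IH _).
Qed.

Lemma dom_eltS n x : vnorm (act (dom_elt g n) x) <= vnorm (act (dom_elt g n.+1) x).
Proof.
rewrite /= !act_mul; apply: le_trans (vnorm_onesqr _ (g_sym n)).1.
exact: dom_elt_ge1.
Qed.

Lemma dom_elt_le m n x : (m <= n)%N ->
  vnorm (act (dom_elt g m) x) <= vnorm (act (dom_elt g n) x).
Proof.
elim: n => [|n IH]; first by rewrite leqn0 => /eqP->.
by rewrite leq_eqVlt => /predU1P[-> //|/IH le]; apply: (le_trans le); apply: dom_eltS.
Qed.

Definition dominated b := exists n (C : R), 0 <= C /\
  forall x, vnorm (act b x) <= C * vnorm (act (dom_elt g n) x).

Lemma dominatedW b n (C : R) m : (n <= m)%N -> 0 <= C ->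
  (forall x, vnorm (act b x) <= C * vnorm (act (dom_elt g n) x)) ->
  forall x, vnorm (act b x) <= C * vnorm (act (dom_elt g m) x).
Proof.
move=> nm C0 bC x; apply: le_trans (bC x) _.
by rewrite ler_wpM2l // dom_elt_le.
Qed.

Lemma dominatedD a b : dominated a -> dominated b -> dominated (a + b).
Proof.
move=> [n [C [C0 aC]]] [m [C' [C'0 bC]]]; exists (maxn n m), (C + C').
split=> [|x]; first exact: addr_ge0.
rewrite act_add mulrDl; apply: le_trans (vnormD _ _) _.
by apply: lerD; apply: dominatedW; [exact: leq_maxl| | | exact: leq_maxr | |].
Qed.

Lemma dominatedZ (k : R[i]) a : dominated a -> dominated (k *: a).
Proof.
have k0 := Re_norm_ge0 k.
move=> [n [C [C0 aC]]]; exists n, (complex.Re `|k| * C).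
split=> [|x]; first exact: mulr_ge0.
by rewrite act_scale vnormZ -mulrA ler_wpM2l.
Qed.

(** Commuting the factors leads to the square of one [dom_elt], which is a factor of the next one;
    hence the successor index. *)
Lemma dominatedM a b : dominated a -> dominated b -> dominated (amul a b).
Proof.
move=> [n [C [C0 aC]]] [m [C' [C'0 bC]]]; exists (maxn n m).+1, (C * C').
split=> [|x]; first exact: mulr_ge0.
set k := maxn n m.
have := dominatedW (leq_maxl n m) C0 aC (act b x) => /= le1; rewrite act_mul.
apply: (le_trans le1); rewrite -mulrA ler_wpM2l // actC.
have := dominatedW (leq_maxr n m) C'0 bC (act (dom_elt g k) x) => /= le2.
apply: (le_trans le2); rewrite ler_wpM2l // /= !act_mul.
exact: (vnorm_onesqr _ (g_sym k)).1.
Qed.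

Lemma dominated_one : dominated aone.
Proof. by exists 0%N, 1; split=> // x; rewrite mul1r. Qed.

Lemma dominated_gen n : dominated (g n).
Proof.
exists n.+1, 1; split=> // x; rewrite mul1r /=.
rewrite !act_mul; apply: le_trans (vnorm_onesqr _ (g_sym n)).2.
by rewrite ![act (g n) (act _ _)]actC; do 2!apply: (le_trans _ (dom_elt_ge1 _ _)).
Qed.

Hypothesis g_gen :
  forall B : set A, unital_star_subalgebra B -> (forall n, B (g n)) -> B = setT.

Lemma all_dominated b : dominated b.
Proof.
(* Asking for both makes the set closed under the involution. *)
pose B := [set b | dominated b /\ dominated (star b)].
suff BT : B = setT by have [] : B b by rewrite BT.
apply: g_gen => [|n]; last by split; rewrite ?g_sym; apply: dominated_gen.
rewrite /B; split=> /=.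
- by rewrite star_one; split; apply: dominated_one.
- by move=> a c [? ?] [? ?]; rewrite starD; split; apply: dominatedD.
- by move=> k a [? ?]; rewrite starZ; split; apply: dominatedZ.
- by move=> a c [? ?] [? ?]; rewrite starM; split; apply: dominatedM.
by move=> a [? ?]; rewrite starK.
Qed.

Lemma dom_elt_cauchy (u : nat -> domain pi) :
  (forall n (e : R), 0 < e -> exists N, forall m, (N <= m)%N ->
     vnorm (act (dom_elt g n) (u m - u N)) <= e) -> graph_cauchy_seq u.
Proof.
move=> uC b e e0; have [n [C [C0 bC]]] := all_dominated b.
have C1 : 0 < C + 1 by rewrite ltr_wpDl.
have [N uN] := uC n (e / (C + 1)) (divr_gt0 e0 C1).
exists N => m /uN le; apply: (le_trans (bC _)).
move: le; rewrite ler_pdivlMr // => le; apply: le_trans le.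
have := vnorm_ge0 (act (dom_elt g n) (u m - u N)); nra.
Qed.

(** The norms increase with [n], so from index [n] on all increments are summable in the fixed norm
    of [dom_elt g n]. *)
Lemma geometric_cauchy (u : nat -> domain pi) (C : R) :
  (forall n, vnorm (act (dom_elt g n) (u n.+1 - u n)) <= C * 2^-1 ^+ n) ->
  graph_cauchy_seq u.
Proof.
move=> uC; apply: dom_elt_cauchy => n e e0.
have C0 : 0 <= C.
  by have := uC 0%N; rewrite expr0 mulr1; apply: le_trans; apply: vnorm_ge0.
(* The right-hand side is the sum of [C / 2^j] over the [k] indices from [N] on. *)
have tail N k : (n <= N)%N ->
    vnorm (act (dom_elt g n) (u (N + k)%N - u N)) <= 2 * C * 2^-1 ^+ N * (1 - 2^-1 ^+ k).
  move=> nN; elim: k => [|k IH].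
    by rewrite addn0 subrr raddf0 vnorm0 expr0 subrr mulr0.
  have nNk : (n <= N + k)%N := leq_trans nN (leq_addr k N).
  have le1 := le_trans (dom_elt_le (u (N + k).+1 - u (N + k)%N) nNk) (uC _).
  rewrite addnS; have -> : u (N + k).+1 - u N =
      (u (N + k).+1 - u (N + k)%N) + (u (N + k)%N - u N).
    by rewrite addrA subrK.
  rewrite raddfD; apply: le_trans (vnormD _ _) _; apply: le_trans (lerD le1 IH) _.
  by rewrite exprD exprSr; lra.
have [||||M CM] := @expr_small R 2^-1 (2 * C) e; [lra|lra|lra|by []|].
have nN := leq_maxl n M; set N := maxn n M in nN *.
exists N => m Nm; rewrite -(subnKC Nm).
apply: (le_trans (tail _ _ nN)); apply: le_trans (CM _ (leq_maxr n M)).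
by rewrite ler_piMr ?mulr_ge0 ?exprn_ge0 ?invr_ge0 // lerBlDr lerDl exprn_ge0 ?invr_ge0.
Qed.

End Dominating.

(** * Cut-off operators *)

Section SquareRoot.
Context {R : realType} {A : unitalStarAlgType R} {D : cstarAlgType R}
  {E : hilbertModType D} (pi : representation A E).
Implicit Types (a b : A) (x y : domain pi).

Fixpoint sqrt_scal n : R := if n is m.+1 then 2^-1 * (1 + sqrt_scal m ^+ 2) else 0.

Lemma sqrt_scal_itv n : 0 <= sqrt_scal n <= 1.
Proof. by elim: n => [|n /andP[]] /=; [rewrite lexx ler01 | set s := sqrt_scal n; nra]. Qed.

(** The defect [d = 1 - s] evolves by [d - d^2 / 2], which is increasing for [d <= 1] and decays
    like [2 / n]. *)
Lemma sqrt_scal_rate n : 1 - sqrt_scal n <= 2 / n.+1%:R.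
Proof.
case: n => [|n]; first by rewrite /= subr0 invr1; lra.
elim: n => [|n]; first by rewrite /= expr0n /=; lra.
have /andP[] := sqrt_scal_itv n.+1; rewrite [in X in _ -> X]/=.
move: (sqrt_scal n.+1) => s s0 s1.
have n1 : (1 : R) <= n.+1%:R by rewrite ler1n.
rewrite -[n.+3%:R]natr1 -[n.+2%:R]natr1; set t : R := n.+1%:R in n1 *.
rewrite !ler_pdivlMr; [|lra|lra].
nra.
Qed.

Lemma sqrt_scal_lim (x : R) C : (forall n, x <= C * (1 - sqrt_scal n)) -> x <= 0.
Proof.
move=> xC; apply/ler_addgt0Pr => e e0; rewrite add0r.
have [C0|C0] := leP C 0.
  have := xC 0%N; rewrite /=; lra.
have [N CN] : exists N : nat, 2 * C / e < N.+1%:R.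
  by exists (Num.truncn (2 * C / e)); rewrite truncnS_gt.
have := xC N; have := sqrt_scal_rate N => r.
move=> /le_trans; apply; apply: (le_trans (ler_wpM2l (ltW C0) r)).
by rewrite mulrA ler_pdivrMr // mulrC [_ * N.+1%:R]mulrC -ler_pdivrMr // ltW.
Qed.

Variable z : {linear domain pi -> domain pi}.
Hypothesis z_contr : forall x, vnorm (z x) <= vnorm x.
Hypothesis z_act : forall b x, z (act b x) = act b (z x).
Hypothesis z_sym : forall x y, vip (z x) y = vip x (z y).

(* Iterating [w = (z + w^2) / 2] from [0] gives [1 - sqrt (1 - z)]; the bounds are
   those of the scalar case [z = 1]. *)
Fixpoint sqrt_iter n : {linear domain pi -> domain pi} :=
  if n is m.+1 then (2^-1 : R)%:C \*: (z \+ (sqrt_iter m \o sqrt_iter m)) else \0.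

Local Notation w := sqrt_iter.
Local Notation s := sqrt_scal.

Lemma sqrt_iterS n x : w n.+1 x = (2^-1 : R)%:C *: (z x + w n (w n x)).
Proof. by []. Qed.

Lemma sqrt_iter_bound n x : vnorm (w n x) <= s n * vnorm x.
Proof.
elim: n x => [|n IH] x; first by rewrite /= vnorm0 mul0r.
rewrite sqrt_iterS vnormZr ger0_norm // [s n.+1]/= -mulrA ler_wpM2l //.
apply: le_trans (vnormD _ _) _; rewrite mulrDl mul1r lerD //.
apply: (le_trans (IH _)); rewrite expr2 -mulrA ler_wpM2l //.
by case/andP: (sqrt_scal_itv n).
Qed.

(** The splitting of [w' w' - w w] as [w' (w' - w) + (w' - w) w] turns operator bounds into the
    scalar identity for [s' ^+ 2 - s ^+ 2]. *)
Lemma sqrt_iter_diff n k x :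
  vnorm (w (n + k)%N x - w n x) <= (s (n + k)%N - s n) * vnorm x.
Proof.
elim: n x => [|n IH] x; first by rewrite /= add0n !subr0 sqrt_iter_bound.
rewrite addSn !sqrt_iterS /= -scalerBr vnormZr ger0_norm // -mulrBr -mulrA ler_wpM2l //.
set w' := w (n + k)%N; set s' := s (n + k)%N.
have -> : z x + w' (w' x) - (z x + w n (w n x)) =
    w' (w' x - w n x) + (w' (w n x) - w n (w n x)).
  by rewrite linearB /=; lmod_ring.
apply: le_trans (vnormD _ _) _.
apply: le_trans (lerD (sqrt_iter_bound _ _) (IH _)) _.
have /andP[s0 _] := sqrt_scal_itv n; have /andP[s'0 _] := sqrt_scal_itv (n + k).
have ds : 0 <= (s' - s n) * vnorm x by apply: le_trans (IH x); apply: vnorm_ge0.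
have le1 := ler_wpM2l s'0 (IH x).
(* By the induction hypothesis [(s' - s n) |x|] is nonnegative, so a negative difference forces
   [x = 0]. *)
have [le2|lt2] := leP 0 (s' - s n).
  have := ler_wpM2l le2 (sqrt_iter_bound n x); rewrite -/s' in le1 *; nra.
have x0 : vnorm x = 0 by have := vnorm_ge0 x; nra.
by rewrite (vnorm_eq0 x0) !(raddf0, subrr, vnorm0, mulr0, addr0).
Qed.

Lemma sqrt_iter_act n b x : w n (act b x) = act b (w n x).
Proof.
elim: n x => [|n IH] x; first by rewrite /= raddf0.
by rewrite !sqrt_iterS z_act !IH actZ actD.
Qed.

Lemma sqrt_iter_comm (B : {linear domain pi -> domain pi}) n x :
  (forall y, z (B y) = B (z y)) -> w n (B x) = B (w n x).
Proof.
move=> zB; elim: n x => [|n IH] x; first by rewrite /= raddf0.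
by rewrite !sqrt_iterS zB !IH linearZ [in RHS]linearD.
Qed.

Lemma sqrt_iter_sym n x y : vip (w n x) y = vip x (w n y).
Proof.
elim: n x y => [|n IH] x y.
  by rewrite /vip /= -inner_star !inner0r star0.
rewrite !sqrt_iterS /vip !valZ !valD innerZl innerZr innerDl innerDr.
by rewrite conj_Creal ?complex_real // -!/(vip _ _) z_sym !IH.
Qed.

Lemma sqrt_iter_le n x : vnorm (w n x) <= vnorm (z x).
Proof.
elim: n x => [|n IH] x; first by rewrite /= vnorm0 vnorm_ge0.
rewrite sqrt_iterS vnormZr ger0_norm //.
have := vnormD (z x) (w n (w n x)); have := sqrt_iter_bound n (w n x); have := IH x.
have /andP[] := sqrt_scal_itv n; have := vnorm_ge0 (w n x); nra.
Qed.

Lemma sqrt_iter_tail n m b x : (n <= m)%N ->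
  vnorm (act b (w m x - w n x)) <= (1 - s n) * vnorm (act b x).
Proof.
move=> nm; rewrite raddfB /= -!sqrt_iter_act -(subnKC nm).
apply: (le_trans (sqrt_iter_diff _ _ _)); rewrite ler_wpM2r ?vnorm_ge0 //.
by rewrite lerD2r; case/andP: (sqrt_scal_itv (n + (m - n))).
Qed.

Hypothesis pi_closed : rep_closed pi.

Lemma sqrt_iter_limit x : exists v, graph_limit (w ^~ x) v.
Proof.
apply: graph_complete => // b e e0.
have [N CN] : exists N : nat, 2 * vnorm (act b x) / e < N.+1%:R.
  by exists (Num.truncn (2 * vnorm (act b x) / e)); rewrite truncnS_gt.
exists N => n Nn; apply: (le_trans (sqrt_iter_tail _ _ Nn)).
apply: (le_trans (ler_wpM2r (vnorm_ge0 _) (sqrt_scal_rate N))).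
by rewrite mulrAC ler_pdivrMr // [e * _]mulrC -ler_pdivrMr // ltW.
Qed.

Definition sqrt_lim x : domain pi := sval (cid (sqrt_iter_limit x)).
Local Notation W := sqrt_lim.

Lemma sqrt_lim_approx n b x :
  vnorm (act b (W x - w n x)) <= (1 - s n) * vnorm (act b x).
Proof.
apply/ler_addgt0Pr => e e0.
have [N wN] := svalP (cid (sqrt_iter_limit x)) b e e0.
have := wN _ (leq_maxl N n); have := sqrt_iter_tail b x (leq_maxr N n).
rewrite -/(W x) !raddfB /= [vnorm (_ - act b (W x))]vnormC.
by have := vnorm_triB (act b (W x)) (act b (w (maxn N n) x)) (act b (w n x)); lra.
Qed.

Lemma sqrt_lim_approx1 n x : vnorm (W x - w n x) <= (1 - s n) * vnorm x.
Proof. by have := sqrt_lim_approx n aone x; rewrite !act_one. Qed.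

(** Identities pass to the limit through this: the error is a multiple of [1 - s n], which tends to
    0. *)
Lemma eq_sqrt_lim x y C : (forall n, vnorm (x - y) <= C * (1 - s n)) -> x = y.
Proof.
move=> /sqrt_scal_lim xy; apply/eqP; rewrite -subr_eq0; apply/eqP/vnorm_eq0.
by apply/le_anti; rewrite xy vnorm_ge0.
Qed.

Fact sqrt_lim_linear : linear W.
Proof.
move=> k x y.
apply: (@eq_sqrt_lim _ _ (vnorm (k *: x + y) + complex.Re `|k| * vnorm x + vnorm y)) => n.
have -> : W (k *: x + y) - (k *: W x + W y) =
    (W (k *: x + y) - w n (k *: x + y)) - k *: (W x - w n x) - (W y - w n y).
  by rewrite (linearP (w n)); lmod_ring.
apply: (le_trans (vnormB _ _)); rewrite [X in _ <= X]mulrDl; apply: lerD; last first.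
  by rewrite mulrC sqrt_lim_approx1.
apply: (le_trans (vnormB _ _)); rewrite [X in _ <= X]mulrDl; apply: lerD.
  by rewrite mulrC sqrt_lim_approx1.
rewrite vnormZ -mulrA ler_wpM2l //; last by rewrite mulrC sqrt_lim_approx1.
exact: Re_norm_ge0.
Qed.

HB.instance Definition _ := GRing.isLinear.Build _ _ _ _ W sqrt_lim_linear.

(** The bound by [act c] makes [B] continuous for the graph topology, in which the iterates
    converge. *)
Lemma sqrt_lim_comm (B : {linear domain pi -> domain pi}) c x :
  (forall y, z (B y) = B (z y)) -> (forall y, vnorm (B y) <= vnorm (act c y)) ->
  W (B x) = B (W x).
Proof.
move=> zB Bc; apply: (@eq_sqrt_lim _ _ (vnorm (B x) + vnorm (act c x))) => n.
have -> : W (B x) - B (W x) = (W (B x) - w n (B x)) - B (W x - w n x).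
  by rewrite linearB /= (sqrt_iter_comm _ _ zB); lmod_ring.
apply: (le_trans (vnormB _ _)); rewrite mulrDl; apply: lerD.
  by rewrite mulrC sqrt_lim_approx1.
by apply: (le_trans (Bc _)); rewrite mulrC sqrt_lim_approx.
Qed.

Lemma sqrt_lim_act b x : W (act b x) = act b (W x).
Proof. by apply: (sqrt_lim_comm (c := b)) => y; rewrite ?z_act. Qed.

Lemma sqrt_lim_le x : vnorm (W x) <= vnorm (z x).
Proof.
rewrite -subr_le0; apply: (@sqrt_scal_lim _ (vnorm x)) => n.
have := sqrt_iter_le n x; have := sqrt_lim_approx1 n x.
by have := vnormD (W x - w n x) (w n x); rewrite subrK; lra.
Qed.

(** The fixed-point equation of the iteration; it says [(1 - W)^2 = 1 - z]. *)
Lemma sqrt_limE x : z x + W (W x) = 2%:C *: W x.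
Proof.
apply: (@eq_sqrt_lim _ _ (4 * vnorm x)) => n.
have -> : z x + W (W x) - 2%:C *: W x =
    (W (W x) - w n (W x)) + w n (W x - w n x) - 2%:C *: (W x - w n.+1 x).
  by rewrite sqrt_iterS (linearB (w n)); lmod_ring.
have /andP[s0 s1] := sqrt_scal_itv n.
have Wx : vnorm (W x) <= vnorm x by apply: le_trans (sqrt_lim_le x) _.
have s2 : 1 - s n.+1 <= 1 - s n by rewrite /=; nra.
have h1 := sqrt_lim_approx1 n (W x); have h2 := sqrt_lim_approx1 n x.
have h3 := sqrt_iter_bound n (W x - w n x); have h4 := sqrt_lim_approx1 n.+1 x.
have x0 := vnorm_ge0 x; have d0 := vnorm_ge0 (W x - w n x).
apply: (le_trans (vnormB _ _)); rewrite vnormZr ger0_norm //.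
have := vnormD (W (W x) - w n (W x)) (w n (W x - w n x)).
have := ler_wpM2r x0 s2; have := ler_wpM2l (_ : 0 <= 1 - s n) Wx; nra.
Qed.

Lemma sqrt_lim_sym x y : vip (W x) y = vip x (W y).
Proof.
apply/eqP; rewrite -subr_eq0; apply/eqP/rnorm_eq0/le_anti; rewrite rnorm_ge0 andbT.
apply: (@sqrt_scal_lim _ (8 * vnorm x * vnorm y)) => n.
have -> : vip (W x) y - vip x (W y) = vip (W x - w n x) y - vip x (W y - w n y).
  rewrite /vip !raddfB /= innerDl innerDr innerNl innerNr.
  by rewrite -!/(vip _ _) sqrt_iter_sym; lmod_ring.
apply: (le_trans (rnormB _ _)).
have x0 := vnorm_ge0 x; have y0 := vnorm_ge0 y.
have := ler_wpM2r y0 (sqrt_lim_approx1 n x); have := ler_wpM2l x0 (sqrt_lim_approx1 n y).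
have := vip_le (W x - w n x) y; have := vip_le x (W y - w n y); lra.
Qed.

End SquareRoot.

(** * Resolvents and the cut-offs built from them *)

Section Cutoff.
Context {R : realType} {A : unitalStarAlgType R} {D : cstarAlgType R}
  {E : hilbertModType D} (pi : representation A E).
Hypothesis Acomm : forall a b : A, amul a b = amul b a.
Hypothesis pi_closed : rep_closed pi.
Implicit Types (a b c : A) (x y : domain pi).

(** The combination [k + i h] preserves norms, since [(k - i h)(k + i h) = h^2 + k^2 = 1]; it
    dominates [h] and [k] by [vnorm_comb]. *)
Lemma vnorm_commuting_squares (h k : domain pi -> domain pi) x :
  (forall x y, vip (h x) y = vip x (h y)) ->
  (forall x y, vip (k x) y = vip x (k y)) ->
  (forall x, h (k x) = k (h x)) -> (forall x, h (h x) + k (k x) = x) ->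
  vnorm (h x) <= vnorm x /\ vnorm (k x) <= vnorm x.
Proof.
move=> hs ks hk sq.
have comm : vip (h x) (k x) = vip (k x) (h x) by rewrite hs ks hk.
have [le1 le2] := vnorm_comb comm.
suff nE : vnorm (k x + 'i *: h x) = vnorm x by rewrite nE in le1 le2.
apply: (@pexpIrn _ 2); rewrite ?nnegrE ?vnorm_ge0 // !vnorm_sqr; congr rnorm.
have -> : vip x x = vip (h x) (h x) + vip (k x) (k x).
  by rewrite hs ks /vip -innerDr -valD sq.
rewrite /vip valD valZ !(innerDl, innerDr, innerZir, innerZil) -!/(vip _ _) comm.
by lmod_ring.
Qed.

Section Resolvent.
Variable a : A.
Hypothesis a_sym : star a = a.
Hypothesis onesqr_surj : forall y, exists x, act (onesqr a) x = y.

Definition resolvent y : domain pi := sval (cid (onesqr_surj y)).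
Local Notation Q := resolvent.

Lemma resolventK y : act (onesqr a) (Q y) = y.
Proof. exact: svalP (cid (onesqr_surj y)). Qed.

Lemma onesqr_inj : injective (act (pi := pi) (onesqr a)).
Proof.
move=> x y xy; apply/eqP; rewrite -subr_eq0; apply/eqP/vnorm_eq0/le_anti.
rewrite vnorm_ge0 andbT; apply: (le_trans (vnorm_onesqr _ a_sym).1).
by rewrite raddfB /= xy subrr vnorm0.
Qed.

Fact resolvent_linear : linear Q.
Proof.
move=> k x y; apply: onesqr_inj.
by rewrite actD actZ !resolventK.
Qed.

HB.instance Definition _ := GRing.isLinear.Build _ _ _ _ Q resolvent_linear.

Lemma resolvent_act b x : Q (act b x) = act b (Q x).
Proof. by apply: onesqr_inj; rewrite resolventK (actC Acomm) resolventK. Qed.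

Lemma resolvent_le x : vnorm (Q x) <= vnorm x.
Proof. by rewrite -{2}[x]resolventK; exact: (vnorm_onesqr _ a_sym).1. Qed.

Lemma resolvent_sym x y : vip (Q x) y = vip x (Q y).
Proof.
by rewrite -{1}[y]resolventK -vip_acts ?star_onesqr // resolventK.
Qed.

Lemma resolvent_sqr x : act a (act a (Q x)) = x - Q x.
Proof. by rewrite -{2}[x]resolventK act_onesqr addrC addKr. Qed.

(** With [S = 2 a Q] and [h = 2 Q - 1] this is [S^2 = 1 - h^2]. Since [h^2 + S^2 = 1], both [h] and
    [S] are contractions, hence so is [S^2]. *)
Definition cut_sqr x : domain pi := 4%:C *: (Q x - Q (Q x)).

Fact cut_sqr_linear : linear cut_sqr.
Proof. by move=> k x y; rewrite /cut_sqr !linearP; lmod_ring. Qed.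

HB.instance Definition _ := GRing.isLinear.Build _ _ _ _ cut_sqr cut_sqr_linear.

Local Notation z := cut_sqr.
Let S x := 2%:C *: act a (Q x).

Let S_sym x y : vip (S x) y = vip x (S y).
Proof.
rewrite /S /vip !valZ innerZl innerZr conj_Creal ?complex_real //.
by rewrite -!/(vip _ _) vip_acts // resolvent_sym resolvent_act.
Qed.

Let SS x : S (S x) = z x.
Proof.
rewrite /S /z (linearZ_LR Q) /= resolvent_act actZ resolvent_sqr scalerA -rmorphM.
by rewrite -natrM.
Qed.

Let h x := 2%:C *: Q x - x.

Let h_sym x y : vip (h x) y = vip x (h y).
Proof.
rewrite /h /vip !(valD, raddfN, valZ) /= innerDl innerDr innerNl innerNr innerZl innerZr.
by rewrite conj_Creal ?complex_real // -!/(vip _ _) resolvent_sym.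
Qed.

Let hS x : vnorm (h x) <= vnorm x /\ vnorm (S x) <= vnorm x.
Proof.
apply: vnorm_commuting_squares => // {}x.
  by rewrite /h /S !(linearZ, linearB) /= resolvent_act; lmod_ring.
by rewrite SS /h /z !(linearZ, linearB) /=; lmod_ring.
Qed.

Fact cut_sqr_contr x : vnorm (z x) <= vnorm x.
Proof. by rewrite -SS; apply: le_trans (hS _).2 (hS _).2. Qed.

Fact cut_sqr_act b x : z (act b x) = act b (z x).
Proof. by rewrite /z !resolvent_act -linearB -linearZ. Qed.

Fact cut_sqr_sym x y : vip (z x) y = vip x (z y).
Proof. by rewrite -!SS !S_sym. Qed.

Local Notation W := (sqrt_lim cut_sqr_contr cut_sqr_act pi_closed).

Let WQ x : W (Q x) = Q (W x).
Proof.
apply: (sqrt_lim_comm _ _ _ (c := aone)) => y; last by rewrite act_one resolvent_le.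
by rewrite /z !(linearZ, linearB).
Qed.

Let WW x : W (W x) = 2%:C *: W x - z x.
Proof.
apply/eqP; rewrite eq_sym subr_eq addrC; apply/eqP/esym.
exact: (sqrt_limE cut_sqr_contr cut_sqr_act pi_closed).
Qed.

Let W_le x : vnorm (W x) <= vnorm (z x).
Proof. exact: sqrt_lim_le. Qed.

(* With [h = 2 Q - 1 = (1 - a^2) / (1 + a^2)] and [z = 1 - h^2] we have [|h| = 1 - W], so
   this is the positive part of [h]; it lives on the spectral subspace [|a| <= 1]. *)
Definition cutoff x : domain pi := Q x - (2^-1 : R)%:C *: W x.
Local Notation F := cutoff.

Lemma cutoff_act b x : F (act b x) = act b (F x).
Proof. by rewrite /F resolvent_act sqrt_lim_act // -actZ -(linearB (act b)). Qed.

(** [F] is the mean of [h] and [1 - W]. The latter is a contraction because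
    [(1 - W)^2 + S^2 = 1]. *)
Lemma cutoff_contr x : vnorm (F x) <= vnorm x.
Proof.
have -> : F x = (2^-1 : R)%:C *: (h x + (x - W x)) by rewrite /F /h; lmod_ring.
have absh : vnorm (x - W x) <= vnorm x /\ vnorm (S x) <= vnorm x.
  apply: (vnorm_commuting_squares (h := fun x => x - W x)) => // {}x.
  - move=> y; rewrite /vip !raddfB /= innerDl innerDr innerNl innerNr -!/(vip _ _).
    by rewrite sqrt_lim_sym //; exact: cut_sqr_sym.
  - by rewrite /S !(linearZ, linearB) /= sqrt_lim_act // WQ; lmod_ring.
  rewrite SS (linearB W) /= WW.
  by lmod_ring.
rewrite vnormZr ger0_norm //.
have := vnormD (h x) (x - W x); have := (hS x).1; have := absh.1; lra.
Qed.

(** On the range of the positive part, [h] and its absolute value agree: [2 Q - 1 = 1 - W] there. *)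
Let QF x : 2%:C *: Q (F x) = 2%:C *: F x - W (F x).
Proof.
rewrite /F (linearB Q) (linearZ_LR Q) (linearB W) (linearZ_LR W) /= WQ WW /z.
have -> : 4%:C *: (Q x - Q (Q x)) = 2%:C *: (2%:C *: (Q x - Q (Q x))).
  by rewrite scalerA -rmorphM -natrM.
have halfK (u : domain pi) : (2^-1 : R)%:C *: (2%:C *: u) = u.
  by rewrite scalerA -rmorphM mulVf // scale1r.
have doubleK (u : domain pi) : 2%:C *: ((2^-1 : R)%:C *: u) = u.
  by rewrite scalerA -rmorphM divff // scale1r.
rewrite [in RHS]scalerBr [_ *: (2%:C *: W x - _)]scalerBr !halfK [in LHS]scalerBr.
by rewrite [in RHS]scalerBr !doubleK; lmod_ring.
Qed.

(** With [y = (1 + a^2) x] one has [F x = Q (F y)] and [|a F x| <= |F y|]. By [QF],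
    [2 Q F y = 2 F y - W F y], and [|W F y| <= |F y|], so [|F y| <= 2 |F x|]. *)
Lemma cutoff_bound x : vnorm (act a (F x)) <= 2 * vnorm (F x).
Proof.
apply: (le_trans (vnorm_onesqr _ a_sym).2); rewrite -cutoff_act.
set y := act (onesqr a) x.
have -> : F x = Q (F y) by rewrite /y cutoff_act resolvent_act resolventK.
have -> : 2 * vnorm (Q (F y)) = vnorm (2%:C *: Q (F y)) by rewrite vnormZr ger0_norm.
rewrite QF; have := vnormB (2%:C *: F y - W (F y)) (- W (F y)).
rewrite opprK subrK vnormZr ger0_norm // vnormN.
have := W_le (F y).
have := cut_sqr_contr (F y); lra.
Qed.

(** Here [1 - Q = a^2 Q], and [W] is dominated by [S^2] with [S = 2 a Q]. Each error term thus
    carries a factor [a], and becomes small when [a] is scaled down. *)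
Lemma cutoff_approx x : vnorm (F x - x) <= vnorm (act a (act a x)) + vnorm (act a x).
Proof.
have -> : F x - x = - (x - Q x) - (2^-1 : R)%:C *: W x by rewrite /F; lmod_ring.
apply: (le_trans (vnormB _ _)); rewrite vnormN vnormZr ger0_norm //.
have SQ : vnorm (S x) = 2 * vnorm (Q (act a x)).
  by rewrite /S vnormZr ger0_norm // resolvent_act.
have := W_le x; rewrite -SS; have := (hS (S x)).2.
have := resolvent_le (act a x); have := resolvent_le (act a (act a x)).
by rewrite -resolvent_sqr -!resolvent_act; lra.
Qed.

End Resolvent.

Lemma exists_cutoff a : star a = a ->
  (forall b, star b = b -> forall y, exists x, act (pi := pi) (onesqr b) x = y) ->
  forall (c : A) x (e : R), 0 < e -> exists (F : domain pi -> domain pi) (K : R),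
    [/\ 0 <= K, forall b y, F (act b y) = act b (F y), forall y, vnorm (F y) <= vnorm y,
        forall y, vnorm (act a (F y)) <= K * vnorm (F y) &
        vnorm (act c (F x - x)) <= e].
Proof.
move=> aE surj c x e e0.
(* For [t = e / C <= 1] the error for [t a] is at most [t^2] and [t] times the first two summands,
   hence at most [t C = e]. The summand [e] ensures [C > 0] and [t <= 1]. *)
pose C := vnorm (act a (act a (act c x))) + vnorm (act a (act c x)) + e.
have n1 := vnorm_ge0 (act a (act a (act c x))); have n2 := vnorm_ge0 (act a (act c x)).
have C0 : 0 < C by rewrite /C; lra.
pose t := e / C; have t0 : 0 < t by rewrite divr_gt0.
have t1 : t <= 1 by rewrite ler_pdivrMr // /C; lra.
have taE : star (t%:C *: a) = t%:C *: a by rewrite starZr aE.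
exists (cutoff taE (surj _ taE)), (2 / t); split.
- by rewrite divr_ge0 // ltW.
- exact: cutoff_act.
- exact: cutoff_contr.
- move=> y; have := cutoff_bound taE (surj _ taE) y.
  by rewrite act_scale vnormZr gtr0_norm // => le; rewrite mulrAC ler_pdivlMr // mulrC.
rewrite linearB /= -cutoff_act; apply: (le_trans (cutoff_approx _ _ _)).
rewrite !act_scale linearZ /= !vnormZr gtr0_norm // -/t.
have tC : t * C = e by rewrite /t divfK // gt_eqF.
have t1' : 0 <= 1 - t by rewrite subr_ge0.
have := mulr_ge0 t1' (mulr_ge0 (ltW t0) n1); have := mulr_ge0 (ltW t0) (ltW e0).
by move: tC; rewrite /C !mulrDr; lra.
Qed.

End Cutoff.

(** * Spectral radius seminorm *)

(* If [s n] behaves like the norm of a [2^n]-th power, the constant [c] costs nothing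
   in the limit. *)
Lemma squaring_bound (R : realType) (s : nat -> R) (c C t : R) :
  (forall n, 0 <= s n) -> 0 <= c -> 0 <= t ->
  (forall n, s n ^+ 2 <= c * s n.+1) -> (forall n, s n <= C * t ^+ (2 ^ n)) ->
  s 0%N <= c * t.
Proof.
move=> s0 c0 t0 sq sC; rewrite leNgt; apply/negP => lt.
have s00 : 0 < s 0%N by apply: le_lt_trans lt; rewrite mulr_ge0.
have c1 : 0 < c.
  rewrite lt_neqAle c0 andbT; apply/eqP => cE.
  by have := sq 0%N; rewrite -cE mul0r expr2; have := mulr_gt0 s00 s00; lra.
have t1 : 0 < t.
  rewrite lt_neqAle t0 andbT; apply/eqP => tE.
  have := sC 0%N; rewrite -tE expn0 expr1 mulr0; lra.
have ct : 0 < c * t by rewrite mulr_gt0.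
set B := s 0%N / (c * t); have B1 : 1 < B by rewrite ltr_pdivlMr // mul1r.
have B0 : 0 < B by lra.
(* If the claim failed, then [B > 1] and [s n] would outgrow [C t ^+ (2 ^ n)] by the factor
   [B ^+ (2 ^ n)], up to a constant. *)
have grow n : c * (t * B) ^+ (2 ^ n) <= s n.
  elim: n => [|n IH].
    by rewrite expn0 expr1 mulrA /B mulrC divfK // gt_eqF.
  rewrite -(@ler_pM2l _ c) //; apply: le_trans (sq n).
  rewrite expnS mulnC exprM mulrA -expr2 -exprMn ler_pXn2r ?nnegrE //.
  by rewrite mulr_ge0 // exprn_ge0 // mulr_ge0 // ltW.
have Bi : 0 <= B^-1 < 1 by rewrite invr_ge0 ltW //= invf_lt1.
have C0 : 0 <= C.
  by have := le_trans (s0 0%N) (sC 0%N); rewrite expn0 expr1 pmulr_lge0.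
have [||||N /(_ N (leqnn _)) CN] := @expr_small R B^-1 C (c / 2); try by case/andP: Bi.
  by rewrite divr_gt0.
have : c <= C * B^-1 ^+ (2 ^ N).
  rewrite exprVn ler_pdivlMr ?exprn_gt0 //.
  rewrite -(@ler_pM2r _ (t ^+ (2 ^ N))) ?exprn_gt0 // -mulrA -exprMn [B * t]mulrC.
  exact: le_trans (grow N) (sC N).
have : B^-1 ^+ (2 ^ N) <= B^-1 ^+ N.
  by rewrite ler_wiXn2l ?(ltnW (ltn_expl _ _)) //; case/andP: Bi => // _ /ltW.
move=> /(ler_wpM2l C0); lra.
Qed.

Section Seminorm.
Context {R : realType} {A : unitalStarAlgType R} {D : cstarAlgType R}
  {E : hilbertModType D} (pi : representation A E).
Hypothesis Acomm : forall a b : A, amul a b = amul b a.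
Implicit Types (a b c : A) (x y : domain pi).

Lemma iter_actC n a b x : iter n (act a) (act b x) = act b (iter n (act a) x).
Proof. by elim: n => //= n ->; rewrite (actC Acomm). Qed.

Lemma iter_actD n a x y : iter n (act a) (x + y) = iter n (act a) x + iter n (act a) y.
Proof. by elim: n => //= n ->; rewrite actD. Qed.

Lemma iter_actM n a b x :
  iter n (act (amul a b)) x = iter n (act a) (iter n (act b) x).
Proof. by elim: n => //= n ->; rewrite act_mul -iter_actC. Qed.

Lemma iter_act_scale n (k : R[i]) a x :
  iter n (act (k *: a)) x = k ^+ n *: iter n (act a) x.
Proof.
elim: n => [|n IH]; first by rewrite expr0 scale1r.
by rewrite !iterS IH act_scale actZ scalerA exprS.
Qed.

Lemma vip_iter n a x y : vip (iter n (act a) x) y = vip x (iter n (act (star a)) y).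
Proof. by elim: n x y => //= n IH x y; rewrite vip_act IH iter_actC. Qed.

Lemma vnorm_iter_star n a x :
  vnorm (iter n (act a) x) ^+ 2 <= 4 * vnorm x * vnorm (iter n (act (amul (star a) a)) x).
Proof. by rewrite vnorm_sqr vip_iter -iter_actM vip_le. Qed.

(** Squaring repeatedly replaces the uncontrolled constant [C] by [4 |x|]. *)
Lemma vnorm_act_growth a x (C t : R) : star a = a -> 0 <= t ->
  (forall n, vnorm (iter n (act a) x) <= C * t ^+ n) ->
  vnorm (act a x) <= 4 * vnorm x * t.
Proof.
move=> aE t0 aC.
apply: (@squaring_bound _ (fun n => vnorm (iter (2 ^ n) (act a) x)) _ C) => //.
- by move=> n; apply: vnorm_ge0.
- by rewrite mulr_ge0 ?vnorm_ge0.
move=> n; apply: (le_trans (vnorm_iter_star _ _ _)).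
by rewrite aE iter_actM -iterD addnn -mul2n -expnS.
Qed.

Variable x0 : domain pi.

Definition act_bounded c := exists2 K : R, 0 <= K &
  forall b, vnorm (act c (act b x0)) <= K * vnorm (act b x0).

Lemma act_bounded_alg :
  unital_star_subalgebra [set c | act_bounded c /\ act_bounded (star c)].
Proof.
have bD a c : act_bounded a -> act_bounded c -> act_bounded (a + c).
  move=> [K K0 aK] [L L0 cL]; exists (K + L) => [|b]; first exact: addr_ge0.
  by rewrite act_add mulrDl; apply: le_trans (vnormD _ _) (lerD _ _).
have bZ (k : R[i]) a : act_bounded a -> act_bounded (k *: a).
  have k0 := Re_norm_ge0 k.
  move=> [K K0 aK]; exists (complex.Re `|k| * K) => [|b]; first exact: mulr_ge0.
  by rewrite act_scale vnormZ -mulrA ler_wpM2l.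
have bM a c : act_bounded a -> act_bounded c -> act_bounded (amul a c).
  move=> [K K0 aK] [L L0 cL]; exists (K * L) => [|b]; first exact: mulr_ge0.
  rewrite act_mul -[act c _]act_mul; apply: (le_trans (aK _)).
  by rewrite act_mul -mulrA ler_wpM2l.
split=> /=.
- by rewrite star_one; split; exists 1 => // b; rewrite act_one mul1r.
- by move=> a c [? ?] [? ?]; rewrite starD; split; apply: bD.
- by move=> k a [? ?]; rewrite starZ; split; apply: bZ.
- by move=> a c [? ?] [? ?]; rewrite starM; split; apply: bM.
by move=> a [? ?]; rewrite starK.
Qed.

Hypothesis all_bounded : forall c, act_bounded c.

(** The infimum of these rates is the spectral radius of [c] on the orbit of [x0]. The free constant
    [C] absorbs the factor 4 of [vip_le]. *)
Definition growth_rate c (t : R) := 0 <= t /\ exists2 C : R, 0 <= C &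
  forall n b, vnorm (iter n (act c) (act b x0)) <= C * t ^+ n * vnorm (act b x0).

Lemma iter_act_orbit n a b : exists d, iter n (act a) (act b x0) = act d x0.
Proof.
elim: n => [|n [d IH]]; first by exists b.
by exists (amul a d); rewrite iterS IH act_mul.
Qed.

Lemma growth_rate_exists c : exists t, growth_rate c t.
Proof.
have [K K0 cK] := all_bounded c; exists K; split=> //; exists 1 => // n b.
elim: n => [|n IH]; first by rewrite expr0 !mul1r.
rewrite iterS; have [d dE] := iter_act_orbit n c b.
rewrite dE; apply: (le_trans (cK d)); rewrite -dE exprS mul1r -mulrA ler_wpM2l //.
by rewrite mul1r in IH.
Qed.

Lemma growth_rateW c s t : s <= t -> growth_rate c s -> growth_rate c t.
Proof.
move=> st [s0 [C C0 cC]]; split; first exact: le_trans st.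
exists C => // n b; apply: (le_trans (cC n b)).
by rewrite ler_wpM2r ?vnorm_ge0 // ler_wpM2l // lerXn2r ?nnegrE // (le_trans s0).
Qed.

Lemma growth_rateD a c s t :
  growth_rate a s -> growth_rate c t -> growth_rate (a + c) (s + t).
Proof.
move=> [s0 [C C0 aC]] [t0 [L L0 cL]]; split; first exact: addr_ge0.
exists (C * L) => [|n b]; first exact: mulr_ge0.
(* Carrying powers of [a] and [c] through the induction replaces the binomial formula. *)
suff H k l : vnorm (iter n (act (a + c)) (iter k (act a) (iter l (act c) (act b x0))))
    <= C * s ^+ k * (L * t ^+ l) * (s + t) ^+ n * vnorm (act b x0).
  by apply: le_trans (H 0%N 0%N) _; rewrite !expr0 !mulr1.
elim: n k l => [|n IH] k l.
  rewrite expr0 mulr1 /=; have [d dE] := iter_act_orbit l c b.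
  rewrite dE; apply: (le_trans (aC k d)); rewrite -dE -[X in _ <= X]mulrA ler_wpM2l //.
  by rewrite mulr_ge0 // exprn_ge0.
rewrite iterSr act_add iter_actD; apply: (le_trans (vnormD _ _)).
have := IH k.+1 l; have := IH k l.+1.
rewrite /= -!iter_actC /= !exprS => h1 h2; apply: (le_trans (lerD h2 h1)).
by rewrite le_eqVlt; apply/orP; left; apply/eqP; ring.
Qed.

Lemma growth_rateM a c s t :
  growth_rate a s -> growth_rate c t -> growth_rate (amul a c) (s * t).
Proof.
move=> [s0 [C C0 aC]] [t0 [L L0 cL]]; split; first exact: mulr_ge0.
exists (C * L) => [|n b]; first exact: mulr_ge0.
rewrite iter_actM; have [d dE] := iter_act_orbit n c b.
rewrite dE; apply: (le_trans (aC n d)); rewrite -dE exprMn.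
have -> : C * L * (s ^+ n * t ^+ n) = C * s ^+ n * (L * t ^+ n) by ring.
by rewrite -[X in _ <= X]mulrA ler_wpM2l // mulr_ge0 // exprn_ge0.
Qed.

Lemma growth_rateZ (k : R[i]) c t :
  growth_rate c t -> growth_rate (k *: c) (complex.Re `|k| * t).
Proof.
have k0 := Re_norm_ge0 k.
have kX n : complex.Re `|k ^+ n| = complex.Re `|k| ^+ n.
  apply/(@complexI R); rewrite rmorphXn -Re_normE normrX.
  by congr (_ ^+ _); exact: Re_normE.
move=> [t0 [C C0 cC]]; split; first exact: mulr_ge0.
exists C => // n b; rewrite iter_act_scale vnormZ kX exprMn.
have -> : C * (complex.Re `|k| ^+ n * t ^+ n) = complex.Re `|k| ^+ n * (C * t ^+ n) by ring.
by rewrite -mulrA ler_wpM2l // exprn_ge0.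
Qed.

(** For [y] in the orbit and [u = |star c^n y|], moving the powers across the inner product gives
    [u^2 <= 4 |y| |c^n (star c^n y)| <= 4 |y| C t^n u]; cancel [u]. *)
Lemma growth_rate_star c t : growth_rate c t -> growth_rate (star c) t.
Proof.
move=> [t0 [C C0 cC]]; split=> //; exists (4 * C) => [|n b]; first exact: mulr_ge0.
have := vnorm_iter_star n (star c) (act b x0); rewrite starK iter_actM.
have [d dE] := iter_act_orbit n (star c) b; have := cC n d; rewrite -dE.
set u := vnorm (iter n (act (star c)) _); set v := vnorm (act b x0).
have u0 : 0 <= u := vnorm_ge0 _; have v0 : 0 <= v := vnorm_ge0 _.
move=> h1 /le_trans /(_ (ler_wpM2l (mulr_ge0 (ler0n _ 4) v0) h1)) h2.
have [->|un0] := eqVneq u 0; first by rewrite !mulr_ge0 // exprn_ge0.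
rewrite -(@ler_pM2r _ u) ?lt_neqAle ?u0 1?eq_sym ?un0 // -expr2.
by apply: (le_trans h2); rewrite le_eqVlt; apply/orP; left; apply/eqP; ring.
Qed.

Lemma growth_rate_sqrt c t : growth_rate (amul (star c) c) t -> growth_rate c (Num.sqrt t).
Proof.
move=> [t0 [C C0 cC]]; split; first exact: sqrtr_ge0.
exists (Num.sqrt (4 * C)) => [|n b]; first exact: sqrtr_ge0.
rewrite -(@ler_pXn2r _ 2) ?nnegrE ?mulr_ge0 ?exprn_ge0 ?sqrtr_ge0 ?vnorm_ge0 //.
apply: (le_trans (vnorm_iter_star _ _ _)).
rewrite !exprMn -exprM mulnC exprM !sqr_sqrtr ?mulr_ge0 //.
have := ler_wpM2l (mulr_ge0 (ler0n _ 4) (vnorm_ge0 (act b x0))) (cC n b).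
by move=> /le_trans; apply; rewrite le_eqVlt; apply/orP; left; apply/eqP; ring.
Qed.

(** The growth bound needs a self-adjoint element, so it is applied to [amul (star c) c], with rate
    [t * t]. *)
Lemma growth_rate_vnorm c t : growth_rate c t -> vnorm (act c x0) <= 4 * vnorm x0 * t.
Proof.
move=> ct; have [tt0 [C C0 cC]] := growth_rateM (growth_rate_star ct) ct.
have [t0 _] := ct; have x00 := vnorm_ge0 x0.
have := @vnorm_act_growth (amul (star c) c) x0 (C * vnorm x0) (t * t).
rewrite starM starK => /(_ erefl tt0) h.
have {}h : vnorm (act (amul (star c) c) x0) <= 4 * vnorm x0 * (t * t).
  by apply: h => n; have := cC n aone; rewrite !act_one mulrAC.
rewrite -(@ler_pXn2r _ 2) ?nnegrE ?mulr_ge0 ?vnorm_ge0 //.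
apply: (le_trans (vnorm_iter_star 1 c x0)) => /=.
have := ler_wpM2l (mulr_ge0 (ler0n _ 4) x00) h.
by move=> /le_trans; apply; rewrite le_eqVlt; apply/orP; left; apply/eqP; ring.
Qed.

Definition spectral_norm c : R := inf [set t | growth_rate c t].

Lemma spectral_norm_le c t : growth_rate c t -> spectral_norm c <= t.
Proof. by move=> ct; apply: ge_inf => //; exists 0 => s [? _]. Qed.

Lemma spectral_norm_ge0 c : 0 <= spectral_norm c.
Proof. by apply: lb_le_inf; [exact: growth_rate_exists | move=> t []]. Qed.

Lemma spectral_norm_rate c (e : R) : 0 < e -> growth_rate c (spectral_norm c + e).
Proof.
move=> e0; have [|t ct lt] := @inf_adherent _ [set t | growth_rate c t] e e0.
  by split; [exact: growth_rate_exists | exists 0 => t []].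
exact: growth_rateW (ltW lt) ct.
Qed.

Lemma spectral_normM a c : spectral_norm (amul a c) <= spectral_norm a * spectral_norm c.
Proof.
have := spectral_norm_ge0 a; have := spectral_norm_ge0 c.
set s := spectral_norm a; set t := spectral_norm c => t0 s0.
apply/ler_addgt0Pr => e e0.
(* For [d <= 1], [(s + d)(t + d)] exceeds [s t] by at most [d (s + t + 1) <= e]. *)
pose d := Num.min 1 (e / (s + t + 1)).
have st0 : 0 < s + t + 1 by lra.
have d0 : 0 < d by rewrite lt_min ltr01 divr_gt0.
have d1 : d <= 1 by rewrite ge_min lexx.
have de : d * (s + t + 1) <= e by rewrite -ler_pdivlMr // ge_min lexx orbT.
have := spectral_norm_le (growth_rateM (spectral_norm_rate a d0) (spectral_norm_rate c d0)).
by rewrite -/s -/t => /le_trans; apply; nra.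
Qed.

Lemma spectral_normZ_le (k : R[i]) c :
  spectral_norm (k *: c) <= complex.Re `|k| * spectral_norm c.
Proof.
have k0 := Re_norm_ge0 k.
apply/ler_addgt0Pr => e e0.
have k1 : 0 < complex.Re `|k| + 1 by lra.
have := spectral_norm_le (growth_rateZ k (spectral_norm_rate c (divr_gt0 e0 k1))).
move=> /le_trans; apply; rewrite mulrDr lerD2l mulrCA ler_piMr ?(ltW e0) //.
by rewrite ler_pdivrMr // mul1r; lra.
Qed.

Lemma spectral_norm_star c : spectral_norm (star c) = spectral_norm c.
Proof.
suff le a : spectral_norm (star a) <= spectral_norm a.
  by apply/le_anti; rewrite le -{1}(starK c) le.
apply/ler_addgt0Pr => e e0.
exact: spectral_norm_le (growth_rate_star (spectral_norm_rate a e0)).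
Qed.

Lemma spectral_norm_cstar : cstar_seminorm (fun c => (spectral_norm c)%:C).
Proof.
split.
- by move=> a; rewrite lecR spectral_norm_ge0.
- move=> a b; rewrite -rmorphD lecR; apply/ler_addgt0Pr => e e0.
  have e20 : 0 < e / 2 by rewrite divr_gt0.
  have ab := growth_rateD (spectral_norm_rate a e20) (spectral_norm_rate b e20).
  have := spectral_norm_le ab.
  by move=> /le_trans; apply; lra.
- move=> k a; have nk := @Re_normE R.
  rewrite {1}[`|k|]nk -rmorphM; congr _%:C; apply/le_anti; rewrite spectral_normZ_le andTb.
  have [->|k0] := eqVneq k 0.
    by rewrite normr0 mul0r spectral_norm_ge0.
  (* The reverse inequality is the proved one for the inverse scalar. *)
  have := spectral_normZ_le k^-1 (k *: a); rewrite scalerA mulVf // scale1r.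
  have kV : complex.Re `|k| * complex.Re `|k^-1| = 1.
    apply/(@complexI R); rewrite rmorphM /= -!nk -normrM divff // normr1 //.
  by move=> /(ler_wpM2l (Re_norm_ge0 k)); rewrite mulrA kV mul1r.
- by move=> a b; rewrite -rmorphM lecR spectral_normM.
move=> a; rewrite -rmorphXn; congr _%:C; apply/le_anti/andP; split.
  by rewrite (le_trans (spectral_normM _ _)) // spectral_norm_star expr2.
(* The other half of the C*-identity: a rate for [amul (star a) a] has a square root that is a rate
   for [a]. *)
apply/ler_addgt0Pr => e e0.
have ae := spectral_norm_rate (amul (star a) a) e0.
have := spectral_norm_le (growth_rate_sqrt ae).
rewrite -(@ler_pXn2r _ 2) ?nnegrE ?sqrtr_ge0 ?spectral_norm_ge0 //.
by rewrite sqr_sqrtr //; case: ae.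
Qed.

Lemma act_bounded_vector : bounded_vector pi (val x0).
Proof.
split; first exact: domainP.
exists (fun c => (spectral_norm c)%:C), (4 * vnorm x0 + 1)%:C; split.
- exact: spectral_norm_cstar.
- by rewrite ltcR; have := vnorm_ge0 x0; lra.
move=> c; rewrite rnormE -rmorphM lecR.
have x00 := vnorm_ge0 x0; have c0 := spectral_norm_ge0 c.
apply: (@le_trans _ _ (4 * vnorm x0 * spectral_norm c)); last by nra.
apply/ler_addgt0Pr => e e0.
have x1 : 0 < 4 * vnorm x0 + 1 by lra.
have := growth_rate_vnorm (spectral_norm_rate c (divr_gt0 e0 x1)).
move=> /le_trans; apply; rewrite mulrDr lerD2l mulrCA ler_piMr ?(ltW e0) //.
by rewrite ler_pdivrMr // mul1r; lra.
Qed.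

End Seminorm.

(** * From integrable to locally bounded *)

Section IntegrableBounded.
Context {R : realType} {A : unitalStarAlgType R} {D : cstarAlgType R}
  {E : hilbertModType D} (pi : representation A E).
Hypothesis Acomm : forall a b : A, amul a b = amul b a.
Hypothesis pi_closed : rep_closed pi.
Hypothesis pi_int : Rep_int pi.
Variable g : nat -> A.
Hypothesis g_sym : forall n, star (g n) = g n.
Hypothesis g_gen :
  forall B : set A, unital_star_subalgebra B -> (forall n, B (g n)) -> B = setT.
Implicit Types (a b c : A) (x y : domain pi).

(** Range density for [dom_elt g n] times [1 + a^2] solves the equation up to [2^-n] in the n-th
    norm. As [1 + a^2] does not decrease these norms, the approximate solutions are graph Cauchy,
    and their limit solves it exactly. *)
Lemma Rep_int_onesqr_surj a y : star a = a -> exists x, act (onesqr a) x = y.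
Proof.
move=> aE.
have near n : exists x,
    vnorm (act (dom_elt g n) (act (onesqr a) x - y)) <= 2^-1 ^+ n.
  have [|||x xy] := @Rep_int_range_dense _ _ _ _ pi (amul (dom_elt g n) (onesqr a))
      (val (act (dom_elt g n) y)) (2^-1 ^+ n) pi_int.
  - by rewrite star_amul ?star_onesqr ?star_dom_elt.
  - move=> x; rewrite act_mul; apply: le_trans (dom_elt_ge1 g_sym n _).
    exact: (vnorm_onesqr _ aE).1.
  - by rewrite exprn_gt0 // invr_gt0.
  by exists x; rewrite raddfB /= -act_mul.
have [u uP] := choice near.
have uC : graph_cauchy_seq u.
  apply: (geometric_cauchy Acomm g_sym g_gen (C := 2)) => n.
  apply: (le_trans (vnorm_onesqr _ aE).1); rewrite (actC Acomm).
  rewrite (linearB (act (onesqr a))) /=.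
  have -> : act (onesqr a) (u n.+1) - act (onesqr a) (u n) =
      (act (onesqr a) (u n.+1) - y) - (act (onesqr a) (u n) - y) by lmod_ring.
  rewrite (raddfB (act (dom_elt g n))); apply: (le_trans (vnormB _ _)).
  have := le_trans (dom_eltS g_sym n (act (onesqr a) (u n.+1) - y)) (uP n.+1).
  by have := uP n; rewrite /= exprSr; have := exprn_ge0 n (_ : 0 <= 2^-1 :> R); lra.
have [x ux] := graph_complete pi_closed uC.
exists x; apply/eqP; rewrite -subr_eq0; apply/eqP/vnorm_eq0/le_anti.
rewrite vnorm_ge0 andbT; apply/ler_addgt0Pr => e e0; rewrite add0r.
have [N uN] := graph_limit_act (onesqr a) ux aone (divr_gt0 e0 (ltr0n _ 2)).
have [||||M MP] := @expr_small R 2^-1 1 (e / 2); [lra|lra|lra|by rewrite divr_gt0|].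
have := uN _ (leq_maxl N M); have := MP _ (leq_maxr N M); rewrite mul1r act_one.
have := le_trans (dom_elt_ge1 g_sym _ _) (uP (maxn N M)).
set v := act _ (u _).
by have := vnorm_triB (act (onesqr a) x) v y; rewrite [vnorm (_ - v)]vnormC; lra.
Qed.

Lemma dominated_seq (s : seq A) : exists N (C : R), 0 <= C /\
  forall a, a \in s -> forall x, vnorm (act a x) <= C * vnorm (act (dom_elt g N) x).
Proof.
elim: s => [|a s [N [C [C0 IH]]]]; first by exists 0%N, 0.
have [M [L [L0 aL]]] := all_dominated pi Acomm g_sym g_gen a.
exists (maxn N M), (C + L); split=> [|b]; first exact: addr_ge0.
rewrite inE => /orP[/eqP -> | bs] x.
  apply: (le_trans (dominatedW g_sym (leq_maxr N M) L0 aL x)).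
  by rewrite ler_wpM2r ?vnorm_ge0 // lerDr.
apply: (le_trans (dominatedW g_sym (leq_maxl N M) C0 (IH b bs) x)).
by rewrite ler_wpM2r ?vnorm_ge0 // lerDl.
Qed.

Lemma iter_comm_cut (F : domain pi -> domain pi) a k x :
  (forall b y, F (act b y) = act b (F y)) ->
  iter k (act a) (F x) = F (iter k (act a) x).
Proof. by move=> Fc; elim: k => //= k ->; rewrite Fc. Qed.

(* Cutting off one generator after the other, with summable errors. *)
Lemma Rep_int_bounded_dense x N (e : R) : 0 < e ->
  exists2 y, bounded_vector pi (val y) & vnorm (act (dom_elt g N) (y - x)) <= e.
Proof.
move=> e0.
(* At stage [n] the error is measured in the norm of index [N + n]: this serves both convergence and
   the final estimate in the norm of index [N]. *)
pose P (p : nat * domain pi) (FK : (domain pi -> domain pi) * R) :=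
  [/\ 0 <= FK.2, forall b y, FK.1 (act b y) = act b (FK.1 y),
      forall y, vnorm (FK.1 y) <= vnorm y,
      forall y, vnorm (act (g p.1) (FK.1 y)) <= FK.2 * vnorm (FK.1 y) &
      vnorm (act (dom_elt g (N + p.1)) (FK.1 p.2 - p.2)) <= e / 2 * 2^-1 ^+ p.1].
have [G GP] : {G & forall p, P p (G p)}.
  apply: choice => -[n v].
  have [||F [K FK]] := @exists_cutoff _ _ _ _ pi Acomm pi_closed _ (g_sym n) _
      (dom_elt g (N + n)) v (e / 2 * 2^-1 ^+ n).
  - by move=> b bE y; apply: Rep_int_onesqr_surj.
  - by rewrite mulr_gt0 ?divr_gt0 ?exprn_gt0 ?invr_gt0.
  by exists (F, K).
pose fix u n : domain pi := if n is m.+1 then (G (m, u m)).1 (u m) else x.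
have uS n : u n.+1 = (G (n, u n)).1 (u n) by [].
have step n : vnorm (act (dom_elt g (N + n)) (u n.+1 - u n)) <= e / 2 * 2^-1 ^+ n.
  by rewrite uS; case: (GP (n, u n)).
have uC : graph_cauchy_seq u.
  apply: (geometric_cauchy Acomm g_sym g_gen (C := e / 2)) => n.
  by apply: le_trans (step n); apply: dom_elt_le => //; exact: leq_addl.
have [y uy] := graph_complete pi_closed uC.
have near n : vnorm (act (dom_elt g N) (u n - x)) <= e * (1 - 2^-1 ^+ n).
  elim: n => [|n IH]; first by rewrite subrr raddf0 vnorm0 expr0 subrr mulr0.
  have := vnorm_triB (act (dom_elt g N) (u n.+1)) (act (dom_elt g N) (u n))
    (act (dom_elt g N) x).
  rewrite -!raddfB => /le_trans; apply.
  have := dom_elt_le g_sym (u n.+1 - u n) (leq_addr n N).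
  by move=> /le_trans /(_ (step n)) h; rewrite exprSr; lra.
exists y; last first.
  have lim : graph_limit (fun n => act (dom_elt g N) (u n + (-1)%:C *: x))
      (act (dom_elt g N) (y + (-1)%:C *: x)).
    apply: graph_limit_act; apply: graph_limitD => // b d d0.
    by exists 0%N => n _; rewrite subrr raddf0 vnorm0 ltW.
  have xN (v : domain pi) : v + (-1)%:C *: x = v - x by rewrite rmorphN1 scaleN1r.
  rewrite -xN; apply: (graph_limit_vnorm_le lim); exists 0%N => n _; rewrite xN.
  apply: (le_trans (near n)); rewrite ler_piMr ?(ltW e0) // lerBlDr lerDl.
pose K j := (G (j, u j)).2.
have K0 j : 0 <= K j by case: (GP (j, u j)).
(* The j-th cut-off yields the bound for [u j.+1]; later cut-offs commute with [A] and are
   contractions, so they preserve it. *)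
have bound j b k n : (j < n)%N ->
    vnorm (iter k (act (g j)) (act b (u n))) <= K j ^+ k * vnorm (act b (u j.+1)).
  elim: n => // n IH; rewrite ltnS leq_eqVlt => /predU1P[<-|jn]; last first.
    have [_ Fc Fle _ _] := GP (n, u n).
    by rewrite uS -Fc (iter_comm_cut _ _ _ Fc); apply: (le_trans (Fle _)); apply: IH.
  have [_ Fc Fle FK _] := GP (j, u j).
  rewrite uS -Fc; move: (act b (u j)) => v.
  elim: k v {IH} => [|k IHk] v; first by rewrite expr0 mul1r.
  rewrite iterSr -Fc; apply: (le_trans (IHk _)).
  by rewrite Fc exprSr -mulrA ler_wpM2l ?exprn_ge0 //; apply: FK.
have lim j b k : vnorm (iter k (act (g j)) (act b y)) <= K j ^+ k * vnorm (act b (u j.+1)).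
  apply: (graph_limit_vnorm_le (u := fun n => iter k (act (g j)) (act b (u n)))).
    elim: k => [|k IHk]; first exact: graph_limit_act.
    exact: (graph_limit_act (g j) IHk).
  by exists j.+1 => n jn; apply: bound.
(* In the limit the powers of [g j] are still controlled by [|b u_(j+1)|] instead of [|b y|]; the
   growth argument replaces it by [4 |b y|]. *)
have gen j : act_bounded y (g j).
  exists (4 * K j) => [|b]; first by rewrite mulr_ge0.
  rewrite mulrAC; apply: (vnorm_act_growth Acomm (C := vnorm (act b (u j.+1)))) => // k.
  by rewrite mulrC; apply: lim.
apply: (act_bounded_vector Acomm) => c.
pose B := [set c | act_bounded y c /\ act_bounded y (star c)].
suff BT : B = setT by have [] : B c by rewrite BT.
by apply: g_gen => [|n]; [apply: act_bounded_alg | split; rewrite ?g_sym; apply: gen].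
Qed.

Lemma Rep_int_Rep_b : Rep_b pi.
Proof.
move=> x xd U [s [_ [/complex_gt0[e e0 ->] sU]]].
have [N [C [C0 sC]]] := dominated_seq (aone :: s).
(* The graph norm is at most [|v| + |a v|], each term at most [C] times the dominating norm; the
   extra 1 gives strictness unless that norm is 0. *)
have C1 : 0 < 2 * C + 1 by lra.
have [y yb yx] := Rep_int_bounded_dense (mkdom xd) N (divr_gt0 e0 C1).
exists (val y); split=> //; apply: sU => [|a sa]; first exact: domainP.
apply: le_lt_trans (graph_norm_le a (mkdom xd - y)) _; rewrite ltcR.
rewrite -[mkdom xd - y]opprB raddfN /= !vnormN.
have := sC a; have := sC aone; rewrite !inE eqxx sa orbT.
move=> /(_ isT (y - mkdom xd)) + /(_ isT (y - mkdom xd)).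
rewrite act_one; move: yx; rewrite ler_pdivlMr //.
set t := vnorm (act (dom_elt g N) _) => h1 h2 h3.
have t0 : 0 <= t := vnorm_ge0 _.
have [t00|t1] := eqVneq t 0; first by rewrite t00 !mulr0 in h2 h3; lra.
have : 0 < t by rewrite lt_neqAle eq_sym t1.
lra.
Qed.

End IntegrableBounded.

(** * From locally bounded to integrable *)

Section BoundedIntegrable.
Context {R : realType} {A : unitalStarAlgType R} {D : cstarAlgType R}
  {E : hilbertModType D} (pi : representation A E).
Hypothesis Acomm : forall a b : A, amul a b = amul b a.
Implicit Types (a b c : A) (x y : domain pi) (u v : E).

Lemma cstar_seminorm_real (q : A -> R[i]) : cstar_seminorm q ->
  exists2 r : A -> R, forall a, q a = (r a)%:C &
    [/\ forall a, 0 <= r a,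
        forall a b, r (a + b) <= r a + r b,
        forall (k : R[i]) a, r (k *: a) = complex.Re `|k| * r a,
        forall a b, r (amul a b) <= r a * r b &
        forall a, r (amul (star a) a) = r a ^+ 2].
Proof.
move=> [q0 qD qZ qM qS]; exists (fun a => complex.Re (q a)).
  by move=> a; rewrite RRe_real ?ger0_real.
have qE a : q a = (complex.Re (q a))%:C by rewrite RRe_real ?ger0_real.
split=> [a|a b|k a|a b|a].
- by rewrite -(@lecR R) -qE; exact: q0.
- by rewrite -(@lecR R) rmorphD /= -!qE.
- by apply/(@complexI R); rewrite rmorphM /= -!qE -Re_normE.
- by rewrite -(@lecR R) rmorphM /= -!qE.
by apply/(@complexI R); rewrite rmorphXn /= -!qE.
Qed.

Lemma bounded_vectorP x : bounded_vector pi (val x) <->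
  exists (r : A -> R) (C : R), [/\ cstar_seminorm (fun a => (r a)%:C), 0 < C &
    forall a, vnorm (act a x) <= C * r a].
Proof.
split=> [[_ [q [_ [qS /complex_gt0[C C0 ->] xC]]]]|[r [C [rS C0 xC]]]].
  have [r qE _] := cstar_seminorm_real qS.
  have qr : q = (fun a => (r a)%:C) by apply/funext.
  rewrite qr in qS xC; exists r, C; split=> // a.
  by rewrite -(@lecR R) rmorphM /= -rnormE; exact: xC.
split; first exact: domainP.
exists (fun a => (r a)%:C), C%:C; split=> [//||a]; first by rewrite ltcR.
by rewrite rnormE -rmorphM lecR; exact: xC.
Qed.

Lemma bounded_vector_act b x :
  bounded_vector pi (val x) -> bounded_vector pi (val (act b x)).
Proof.
move=> /bounded_vectorP[r [C [rS C0 xC]]]; apply/bounded_vectorP.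
have [s sE [s0 _ _ sM _]] := cstar_seminorm_real rS.
have rs a : r a = s a by apply: (@complexI R); exact: sE.
have r0 a : 0 <= r a by rewrite rs.
exists r, (C * r b + 1); split=> // [|a]; first by rewrite ltr_wpDl // mulr_ge0 // ltW.
rewrite -act_mul; apply: (le_trans (xC _)).
have : r (amul a b) <= r a * r b by rewrite !rs.
move=> /(ler_wpM2l (ltW C0)) /le_trans; apply; have := r0 a; nra.
Qed.

(* With [s = 1 / (1 + q(a)^2)] the element [c = 1 - s (1 + i a)] has
   [q(c)^2 = q(c^* c) <= (1 - s)^2 + s^2 q(a)^2 = 1 - s < 1], so that the Neumann series
   of [c] nearly inverts [1 + i a] on bounded vectors. *)
Lemma bounded_vector_inverse a x (e : R) : star a = a ->
  bounded_vector pi (val x) -> 0 < e ->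
  exists p, vnorm (x - act (aone + 'i *: a) (act p x)) <= e.
Proof.
move=> aE /bounded_vectorP[r' [C [rS C0 xC']]] e0.
have [r rE [r0 rD rZ rM rstar]] := cstar_seminorm_real rS.
have xC b : vnorm (act b x) <= C * r b.
  by have -> : r b = r' b by apply: (@complexI R); rewrite -rE.
pose s := (1 + r a ^+ 2)^-1.
have ra2 : 0 <= r a ^+ 2 by rewrite exprn_ge0.
have s0 : 0 < s by rewrite invr_gt0; lra.
have sra : s * (1 + r a ^+ 2) = 1 by rewrite mulVf //; apply: lt0r_neq0; lra.
have s1 : s <= 1 by nra.
pose M := aone + 'i *: a.
pose k := s%:C * 'i; pose c := (1 - s)%:C *: aone + (- k) *: a.
have cE y : act c y = y - s%:C *: act M y.
  rewrite /c /M /k !act_add !act_scale act_one; lmod_ring.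
(* The C*-identity at the unit reads [r aone = r aone ^+ 2]. *)
have r1 : r aone <= 1.
  have := rstar aone; rewrite star_one amul1l => r1E; have := r0 aone; nra.
have cc : amul (star c) c = ((1 - s) ^+ 2)%:C *: aone + (s ^+ 2)%:C *: amul a a.
  have -> : star c = (1 - s)%:C *: aone + k *: a.
    rewrite /c starD !starZ star_one aE conj_Creal ?complex_real // /k.
    by rewrite rmorphN rmorphM /= conjCi conj_Creal ?complex_real // mulrN opprK.
  rewrite /c /k !(amulDl, amulDr, amulZl, amulZr, amul1l, amul1r); lmod_ring.
have rc : r c < 1.
  have := rstar c; rewrite cc => rcE.
  have := rD (((1 - s) ^+ 2)%:C *: aone) ((s ^+ 2)%:C *: amul a a).
  have rZr (t : R) b : 0 <= t -> r (t%:C *: b) = t * r b.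
    by move=> t0; rewrite rZ normc_def /= expr0n addr0 sqrtr_sqr ger0_norm.
  rewrite rcE !rZr ?sqr_ge0 //; have := rM a a; have := r0 c.
  move: (r (amul a a)) (r c) (r aone) r1 => t w z z1 w0 t1 h.
  have h1 : (1 - s) ^+ 2 * z <= (1 - s) ^+ 2 by rewrite ler_piMr // exprn_ge0 // subr_ge0.
  have h2 : s ^+ 2 * t <= s ^+ 2 * r a ^+ 2 by rewrite ler_wpM2l ?exprn_ge0 ?(ltW s0).
  have h3 : (1 - s) ^+ 2 + s ^+ 2 * r a ^+ 2 = 1 - s.
    have -> : s ^+ 2 * r a ^+ 2 = s * (s * (1 + r a ^+ 2)) - s ^+ 2 by ring.
    by rewrite sra; ring.
  have : w ^+ 2 < 1 by lra.
  by rewrite expr_lt1.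
(* Neumann series: [p] is the partial sum and [d] the remainder, of size at most [r c ^+ n]. Since
   [c = 1 - s M], adding [s d] to [p] changes the remainder to [c d]. *)
have iter_c n : exists p d, [/\ x - act M (act p x) = act d x & r d <= r c ^+ n].
  elim: n => [|n [p [d [pE dr]]]].
    exists 0, aone; rewrite expr0; split=> //.
    by rewrite -[0](scale0r a) act_scale scale0r raddf0 subr0 act_one.
  exists (p + s%:C *: d), (amul c d); split; last first.
    by rewrite exprS (le_trans (rM _ _)) // ler_wpM2l.
  by rewrite act_mul cE act_add act_scale actD actZ opprD addrA pE.
have [||||n /(_ n (leqnn _)) rn] := @expr_small R (r c) C e; rewrite ?(ltW C0) //.
have [p [d [pE dr]]] := iter_c n; exists p; rewrite pE.
apply: (le_trans (xC d)); apply: le_trans rn; exact: ler_wpM2l (ltW C0) _ _ dr.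
Qed.

Hypothesis pi_b : Rep_b pi.

Lemma bounded_vector_dense u (e : R) : 0 < e ->
  exists2 x : domain pi, bounded_vector pi (val x) & rnorm (val x - u) < e.
Proof.
move=> e0; have e20 : 0 < e / 2 by lra.
have [x xu] := domain_dense pi u e20.
have [|y [[yx yd] yb]] := pi_b (domainP x)
    (U := [set y | rnorm (val x - y) < e / 2 /\ rep_dom pi y]).
  exists [:: aone], (e / 2)%:C; split=> [|y yd /(_ aone)]; first by rewrite ltcR.
  rewrite inE eqxx => /(_ isT) xy; split=> //; rewrite -ltcR.
  apply: le_lt_trans xy.
  have := graph_norm_ge (x - mkdom yd) (star_one (A := A)).
  by rewrite act_one.
exists (mkdom yd) => //=.
by rewrite rnormC in yx; have := rnorm_triB y (val x) u; lra.
Qed.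

(** Invert [1 + i a] approximately, then [1 - i a] on the result, which is again a bounded vector;
    the two factors multiply to [1 + a^2]. *)
Lemma Rep_b_onesqr_dense a u (e : R) : star a = a -> 0 < e ->
  exists x, rnorm (val (act (onesqr a) x) - u) < e.
Proof.
move=> aE e0; have e30 : 0 < e / 3 by lra.
have [x xb xu] := bounded_vector_dense u e30.
have [p px] := bounded_vector_inverse aE xb e30.
set y := act p x in px; set z := act _ y in px.
have yb : bounded_vector pi (val z) by do 2!apply: bounded_vector_act.
have NaE : star (- a) = - a by rewrite starN aE.
have [p' pz] := bounded_vector_inverse NaE yb e30.
exists (act p' y).
have zE : act (aone + 'i *: (- a)) (act p' z) = act (onesqr a) (act p' y).
  rewrite /z (actC Acomm p') !act_add !act_one !act_scale.
  rewrite !(actD, actZ) act_mul -[- a]scaleN1r !act_scale; lmod_ring.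
rewrite zE in pz.
have := rnorm_triB (val (act (onesqr a) (act p' y))) (val z) u.
have := rnorm_triB (val z) (val x) u.
have px' : rnorm (val x - val z) <= e / 3 := px.
have pz' : rnorm (val z - val (act (onesqr a) (act p' y))) <= e / 3 := pz.
by rewrite rnormC in px'; rewrite rnormC in pz'; lra.
Qed.

Lemma Rep_b_range_dense a u (e : R) : star a = a -> 0 < e ->
  exists x, rnorm (val (act a x + 'i *: x) - u) < e.
Proof.
move=> aE e0; have e20 : 0 < e / 2 by lra.
have [x xb xu] := bounded_vector_dense (- 'i *: u) e20.
have NaE : star (- a) = - a by rewrite starN aE.
have [p px] := bounded_vector_inverse NaE xb e20.
set y := act p x in px; exists y.
(* Up to the factor [i], [a + i] is [1 - i a], to which the Neumann series for [- a] applies. *)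
have yE : act a y + 'i *: y = 'i *: act (aone + 'i *: (- a)) y.
  by rewrite act_add act_one act_scale -[- a]scaleN1r act_scale; lmod_ring.
set w := act _ y in px yE; rewrite yE.
have -> : val ('i *: w) - u = 'i *: (val w - - 'i *: u) by rewrite valZ; lmod_ring.
rewrite rnormZi; have := rnorm_triB (val w) (val x) (- 'i *: u).
have px' : rnorm (val x - val w) <= e / 2 := px.
by rewrite rnormC in px'; lra.
Qed.

Lemma inner_domain0 u : (forall x, inner u (val x) = 0) -> u = 0.
Proof.
move=> u0; apply: rnorm_eq0; apply/eqP; rewrite -sqrf_eq0 rnorm_sqr; apply/eqP.
rewrite (@rnorm_small0 _ _ (4 * rnorm u) (inner u u)) ?rnorm0 // => e e0.
have [x xu] := domain_dense pi u e0.
have -> : inner u u = inner u (u - val x) by rewrite innerDr innerNr u0 subr0.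
apply: (le_trans (rnorm_inner _ _)); rewrite ler_wpM2l ?mulr_ge0 ?rnorm_ge0 //.
by rewrite rnormC ltW.
Qed.

Lemma op_closure_sub_adjoint a : star a = a ->
  op_closure pi a `<=` op_adjoint (op_closure pi a).
Proof. by move=> aE [u v] uv x y xy; apply: op_closure_sym xy uv. Qed.

(** A quantitative deficiency argument. Approximate [v + i u] by [(a + i) x]; the differences [u'],
    [v'] still satisfy the adjoint relation and [w = v' + i u'] is small. Density of the range of
    [- a + i] then forces [u'], hence [v'], to be small. *)
Lemma Rep_b_selfadjoint a : star a = a -> op_selfadjoint (op_closure pi a).
Proof.
move=> aE; apply/seteqP; split; last exact: op_closure_sub_adjoint.
move=> [u v] uv; apply/op_closureP => e e0.
have d0 : 0 < e / 20 by lra.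
have [x xuv] := Rep_b_range_dense (v + 'i *: u) aE d0; exists x.
set d := e / 20 in d0 xuv.
pose u' := u - val x; pose v' := v - val (act a x); pose w := v' + 'i *: u'.
have wd : rnorm w < d.
  by rewrite -rnormN; congr (rnorm _ < d) : xuv; rewrite valD valZ /w /u' /v'; lmod_ring.
have u'v' y : inner (val (act a y)) u' = inner (val y) v'.
  rewrite /u' /v' !innerDr !innerNr (uv _ _ (op_closure_graph _ _)) /=.
  by have := vip_acts y x aE; rewrite /vip => ->.
suff : rnorm u' < e /\ rnorm v' < e by [].
have aN y : act (- a) y = - act a y by rewrite -scaleN1r act_scale scaleN1r.
clearbody u' v'.
have NaE : star (- a) = - a by rewrite starN aE.
have [y yu] := Rep_b_range_dense u' NaE d0.
pose z := act (- a) y + 'i *: y; rewrite -/z in yu.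
have yz : vnorm y <= vnorm z by case: (vnorm_comb_sym y NaE).
(* Moving [- a + i] across the inner product turns [u'] into [- w]. *)
have zu : inner (val z) u' = - inner (val y) w.
  rewrite /z aN valD valZ raddfN /= innerDl innerNl innerZil u'v'.
  by rewrite /w innerDr innerZir; lmod_ring.
have uz : inner u' u' = inner (u' - val z) u' - inner (val y) w.
  by rewrite innerDl innerNl zu; lmod_ring.
have n0 := rnorm_ge0 u'; have y0 := vnorm_ge0 y; have w0 := rnorm_ge0 w.
have h1 := rnorm_inner (u' - val z) u'; have h2 := rnorm_inner (val y) w.
have h3 : vnorm z <= rnorm u' + d.
  by have := rnorm_triB (val z) u' 0; rewrite !subr0 /vnorm; lra.
have h4 : rnorm (u' - val z) <= d by rewrite rnormC ltW.
have h5 := rnormB (inner (u' - val z) u') (inner (val y) w).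
rewrite -uz -rnorm_sqr in h5.
have u9 : rnorm u' <= 9 * d.
  (* The estimates give [|u'|^2 <= 8 d |u'| + 4 d^2], impossible for [|u'| > 9 d]. *)
  rewrite leNgt; apply/negP => lt.
  have := ler_wpM2r n0 h4.
  have : vnorm y * rnorm w <= (rnorm u' + d) * d.
    by apply: ler_pM => //; [apply: le_trans h3 | apply: ltW].
  rewrite /vnorm in h2 *; nra.
have v10 : rnorm v' <= 10 * d.
  have -> : v' = w - 'i *: u' by rewrite /w addrK.
  by apply: (le_trans (rnormB _ _)); rewrite rnormZi; lra.
by rewrite /d in u9 v10; split; lra.
Qed.

Lemma Rep_b_regular a : star a = a -> op_regular (op_closure pi a).
Proof.
move=> aE; have T0 : op_closure pi a (0, 0).
  by have := op_closure_graph a (0 : domain pi); rewrite (raddf0 (act a)).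
have dom_dense : forall u (e : R), 0 < e ->
    exists2 x, op_dom (op_closure pi a) x & rnorm (x - u) < e.
  move=> u e e0; have [x xu] := domain_dense pi u e0.
  by exists (val x) => //; exists (val (act a x)); apply: op_closure_graph.
split.
- split=> //.
  + by move=> x y x' y' xy xy'; rewrite -[x']scale1r -[y']scale1r; apply: op_closure_lin.
  + by move=> k x y xy; have := op_closure_lin (k := k) T0 xy; rewrite !add0r.
  + by move=> x y d; apply: op_closure_ract.
  (* Closability: two values at the same point have equal inner products with the dense domain. *)
  + move=> x y z xy xz; apply/eqP; rewrite -subr_eq0; apply/eqP/inner_domain0 => t.
    by rewrite innerDl innerNl (op_closure_dom t aE xy) (op_closure_dom t aE xz) subrr.
- exact/dense_rnormP.
- exact: closed_closure.
- apply/dense_rnormP => u e e0; have [x [y xy] xu] := dom_dense u e e0.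
  by exists x => //; exists y; apply: op_closure_sub_adjoint.
apply/dense_rnormP => u e e0.
have [x xu] := Rep_b_onesqr_dense u aE e0.
exists (val (act (onesqr a) x)) => //.
exists (val x), (val (act a x)), (val (act a (act a x))); split.
- exact: op_closure_graph.
- by apply: op_closure_sub_adjoint => //; apply: op_closure_graph.
by rewrite act_onesqr valD.
Qed.

Lemma Rep_b_Rep_int : Rep_int pi.
Proof. by move=> a aE; split; [apply: Rep_b_regular | apply: Rep_b_selfadjoint]. Qed.

End BoundedIntegrable.

Theorem theorem8p7 (R : realType) (A : unitalStarAlgType R)
  (Acomm : forall a b : A, amul a b = amul b a)
  (Agen : countably_generated A)
  (D : cstarAlgType R) (E : hilbertModType D)
  (pi : representation A E) (pi_closed : rep_closed pi) :
  Rep_int pi <-> Rep_b pi.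
Proof.
have [g g_sym g_gen] := countably_generated_sym Agen.
split=> [pi_int|pi_b]; last exact: Rep_b_Rep_int.
exact: (Rep_int_Rep_b Acomm pi_closed pi_int g_sym g_gen).
Qed.
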